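(* Consider the filtering model $$X_k=f(X_{k-1})+\zeta_k,\qquad Y_k=h(X_k)+\varepsilon_k,$$ with i.i.d. state noise, as described in the context. Assume: (E1) $f$ is $a$-Lipschitz, $h$ is uniformly continuous and surjective, and there are constants $b_0,b$ such that $|x_1-x_2|\le b_0+b|h(x_1)-h(x_2)|$ for all $x_1,x_2\in\mathsf X$; (E2) $\upsilon$ is bounded, $\lim_{|u|\to\infty}\upsilon(u)=0$, and $\inf_{y\in K}\upsilon(y)>0$ for every compact set $K\subset\mathsf Y$; and that for all $\Delta>0$ there exists $\tau>0$ such that the log-moment generating function $\psi_{Z_1^\Delta}(\lambda)=\log\mathbb E[e^{\lambda Z_1^\Delta}]$ is finite on $[0,\tau)$. Let $\{Y_k\}_{k\ge0}$ be the sequence of observations produced by the model. Let $\nu,\nu'$ be probability measures on $(\mathsf X,\mathcal X)$ and $\Delta>0$ be such that, for some $\lambda>0$, $$\mathbb E_\star\Big\{\exp\big(\lambda[\log\nu g(\cdot,Y_0)Q\mathbf 1_{\mathsf C(Y_1,\Delta)}]_-\big)\Big\}<\infty,\qquad \mathbb E_\star\Big\{\exp\big(\lambda[\log\nu' g(\cdot,Y_0)Q\mathbf 1_{\mathsf C(Y_1,\Delta)}]_-\big)\Big\}<\infty .$$ Then $$\limsup_{n\to\infty}n^{-1}\log\mathbb E_\star\Big[\big\|\phi_{\nu,n}[Y_{0:n}]-\phi_{\nu',n}[Y_{0:n}]\big\|_{\mathrm{TV}}\Big]<0 .$$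
   Context: $\mathsf X=\mathbb R^N$ and $\mathsf Y=\mathbb R^p$ with $p\le N$, with Borel $\sigma$-fields $\mathcal X,\mathcal Y$; $f:\mathsf X\to\mathsf X$ and $h:\mathsf X\to\mathsf Y$ are measurable. $\{\varepsilon_k\}_{k\ge0}$ is an i.i.d. sequence with positive density $\upsilon$ with respect to Lebesgue measure on $\mathsf Y$; $\{\zeta_k\}_{k\ge0}$ is an i.i.d. sequence with positive density $\gamma$ with respect to Lebesgue measure on $\mathsf X$, independent of $\{\varepsilon_k\}$. $\mathbb P_\star$ (with expectation $\mathbb E_\star$) is the law under which $\{Y_k\}$ is generated by the model, the initial state $X_0$ having an arbitrary distribution and being independent of the noises. The transition kernel is $Q(x,A)=\int_A\gamma(x'-f(x))\,dx'$ and the likelihood is $g(x,y)=\upsilon(y-h(x))$. For a probability measure $\nu$ on $\mathsf X$, the filtering distribution is $$\phi_{\nu,n}[y_{0:n}](A)=\frac{\int\nu(dx_0)g(x_0,y_0)\prod_{i=1}^nQ(x_{i-1},dx_i)g(x_i,y_i)\mathbf 1_A(x_n)}{\int\nu(dx_0)g(x_0,y_0)\prod_{i=1}^nQ(x_{i-1},dx_i)g(x_i,y_i)} .$$ $\nu g(\cdot,y)Q\mathbf 1_A=\int\nu(dx)g(x,y)Q(x,A)$, $[t]_-=\max(-t,0)$, and $\|\cdot\|_{\mathrm{TV}}$ is the total variation norm. For $\Delta>0$, $\mathsf C(y,\Delta)=\{x\in\mathsf X:|h(x)-y|\le\Delta\}$. For $r\ge0$, $\gamma^-(r)=\inf_{|s|\le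 r}\gamma(s)$ and $\gamma^+(r)=\sup_{|s|\le r}\gamma(s)$; it is understood that $0<\gamma^-(r)\le\gamma^+(r)<\infty$ for all $r$ (so that $y\mapsto\mathsf C(y,\Delta)$ is a local Doeblin set function, i.e. for all $y,y'$ there are constants in $(0,\infty)$ bounding $Q(x,A\cap\mathsf C(y',\Delta))$ below and above by multiples of the Lebesgue measure of $A\cap\mathsf C(y',\Delta)$, uniformly in $x\in\mathsf C(y,\Delta)$ and $A\in\mathcal X$). For $\Delta>0$ and $k\ge1$, $$Z_k^\Delta=-\log\gamma^-\big[2(a+1)b_0+(a+1)b\Delta+ab|\varepsilon_{k-1}|+|\zeta_k|+b|\varepsilon_k|\big].$$ *)

(* Defs.v *)
From HB Require Import structures.
From mathcomp Require Import all_boot all_order all_algebra.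
From mathcomp Require Import all_classical all_reals all_analysis.

Set Implicit Arguments.
Unset Strict Implicit.
Unset Printing Implicit Defensive.
Import Order.TTheory GRing.Theory Num.Theory.
Import numFieldNormedType.Exports.

Local Open Scope classical_set_scope.
Local Open Scope ring_scope.

Definition borel_mx_display : measure_display.
Proof. exact. Qed.

Section borel_mx.
Context {R : realType} (m n : nat).

Definition borel_mx : set (set 'M[R]_(m, n)) := <<s [set A | open A] >>.

Let borel_mx0 : borel_mx set0.
Proof. exact: sigma_algebra0. Qed.

Let borel_mxC A : borel_mx A -> borel_mx (~` A).
Proof. exact: sigma_algebraC. Qed.

Let borel_mx_bigcup (F : (set 'M[R]_(m, n))^nat) :
  (forall i, borel_mx (F i)) -> borel_mx (\bigcup_i F i).
Proof. exact: sigma_algebra_bigcup. Qed.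

HB.instance Definition _ := @isMeasurable.Build borel_mx_display
  'M[R]_(m, n) borel_mx borel_mx0 borel_mxC borel_mx_bigcup.

End borel_mx.

Section euclidean_space.
Context {R : realType}.

(* The library norm of 'rV[R]_n is the sup norm; |.| is the Euclidean one. *)
Definition enorm n (x : 'rV[R]_n) : R := Num.sqrt (\sum_i x ord0 i ^+ 2).

(* Lebesgue measure on R^n, as the n-fold product of the Lebesgue measure on R,
   transported along (t, v) |-> (t, v_0, ..., v_(n-1)). *)
Fixpoint lebesgue_rV (n : nat) : set 'rV[R]_n -> \bar R :=
  match n with
  | 0 => \d_(0 : 'rV[R]_0)
  | n'.+1 => pushforward (lebesgue_measure \x @lebesgue_rV n')%E
      (fun tv : measurableTypeR R * 'rV[R]_n' =>
         row_mx (tv.1)%:M tv.2 : 'rV[R]_(1 + n'))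
  end.

Definition positive_density n (q : 'rV[R]_n -> R) : Prop :=
  [/\ measurable_fun setT q, forall x, 0 < q x
    & (\int[@lebesgue_rV n]_x (q x)%:E = 1)%E].

End euclidean_space.

Section total_variation.
Context d (T : measurableType d) (R : realType).
Local Open Scope ereal_scope.

Definition tv_norm (mu : set T -> \bar R) : \bar R :=
  ereal_sup [set s | exists (m : nat) (A : 'I_m -> set T),
    [/\ forall i, measurable (A i), trivIset setT A,
        \bigcup_i A i = setT & s = \sum_(i < m) `|mu (A i)| ] ].

End total_variation.

Section independence.
Context d (W : measurableType d) (R : realType) (P : probability W R).
Local Open Scope ereal_scope.

Definition independent_seq d' (T : measurableType d') (V : nat -> W -> T) :=
  forall (s : seq nat) (B : nat -> set T), uniq s ->
    (forall k, measurable (B k)) ->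
    P (\bigcap_(k in [set` s]) (V k @^-1` B k)) =
    \prod_(k <- s) P (V k @^-1` B k).

Definition independent_classes (F G : set (set W)) :=
  forall A B, F A -> G B -> P (A `&` B) = P A * P B.

Definition events d' (T : measurableType d') (I : Type) (V : I -> W -> T) :
    set (set W) :=
  [set A | exists (i : I) (B : set T), measurable B /\ A = V i @^-1` B].

Definition has_density n (q : 'rV[R]_n -> R) (V : W -> 'rV[R]_n) :=
  forall B, measurable B ->
    P (V @^-1` B) = \int[@lebesgue_rV R n]_(u in B) (q u)%:E.

Definition iid_with_density n (q : 'rV[R]_n -> R) (V : nat -> W -> 'rV[R]_n) :=
  independent_seq V /\ forall k, has_density q (V k).

End independence.

Section filtering.
Context {R : realType} (N p : nat).
Local Notation X := 'rV[R]_N.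
Local Notation Y := 'rV[R]_p.
Variables (f : X -> X) (h : X -> Y) (gam : X -> R) (ups : Y -> R).
Local Open Scope ereal_scope.

Definition Qker (x : X) (A : set X) : \bar R :=
  \int[@lebesgue_rV R N]_(x' in A) (gam (x' - f x)%R)%:E.

Definition lik (x : X) (y : Y) : R := ups (y - h x)%R.

(* With x = x_k:
   \int \prod_(i = k+1)^(k+m) Q(x_(i-1), dx_i) g(x_i, y_i) 1_A(x_(k+m)). *)
Fixpoint filter_future (y : nat -> Y) (A : set X) (k m : nat) (x : X) : \bar R :=
  match m with
  | 0 => (\1_A x)%:E
  | m'.+1 => \int[Qker x]_x'
               ((lik x' (y k.+1))%:E * filter_future y A k.+1 m' x')
  end.

Definition filter_unnorm (nu : set X -> \bar R) (n : nat) (y : nat -> Y)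
    (A : set X) : \bar R :=
  \int[nu]_x ((lik x (y 0%N))%:E * filter_future y A 0 n x).

Definition filter_dist (nu : set X -> \bar R) (n : nat) (y : nat -> Y)
    (A : set X) : \bar R :=
  filter_unnorm nu n y A / filter_unnorm nu n y setT.

Definition nu_g_Q (nu : set X -> \bar R) (y : Y) (A : set X) : \bar R :=
  \int[nu]_x ((lik x y)%:E * Qker x A).

Definition Cset (y : Y) (Delta : R) : set X :=
  [set x | enorm (h x - y)%R <= Delta]%R.

(* [t]_-, with [-oo]_- = +oo; the logarithm is taken with log 0 = -oo. *)
Definition negpart (t : \bar R) : \bar R := maxe (- t) 0.

Definition gamma_minus (r : R) : \bar R :=
  ereal_inf [set (gam s)%:E | s in [set s | enorm s <= r]%R].

Definition gamma_plus (r : R) : \bar R :=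
  ereal_sup [set (gam s)%:E | s in [set s | enorm s <= r]%R].

End filtering.

(* Z_k^Delta for k >= 1, where k.-1 is the true predecessor. *)
Definition Zvar {R : realType} (N p : nat) (W : Type) (gam : 'rV[R]_N -> R)
    (zeta : nat -> W -> 'rV[R]_N) (eps : nat -> W -> 'rV[R]_p)
    (a b0 b Delta : R) (k : nat) (w : W) : R :=
  - ln (fine (gamma_minus gam
      (2 * (a + 1) * b0 + (a + 1) * b * Delta + a * b * enorm (eps k.-1 w)
       + enorm (zeta k w) + b * enorm (eps k w)))).

Section assumptions.
Context {R : realType} (N p : nat).
Local Notation X := 'rV[R]_N.
Local Notation Y := 'rV[R]_p.

(* Uniform continuity is that of the library's uniform structure, which is the
   one induced by enorm since all norms on R^n are equivalent. *)
Definition assumption_E1 (f : X -> X) (h : X -> Y) (a b0 b : R) : Prop :=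
  [/\ forall x1 x2, enorm (f x1 - f x2) <= a * enorm (x1 - x2),
      unif_continuous h, set_surj setT setT h
    & forall x1 x2, enorm (x1 - x2) <= b0 + b * enorm (h x1 - h x2)].

Definition assumption_E2 (ups : Y -> R) : Prop :=
  [/\ exists M, forall u, ups u <= M,
      forall e, 0 < e -> exists M, forall u, M <= enorm u -> `|ups u| < e
    & forall K : set Y, compact K ->
        (0 < ereal_inf [set (ups y)%:E | y in K])%E].

End assumptions.

(* Main.v *)
Require Import Defs.
From HB Require Import structures.
From mathcomp Require Import all_boot all_order all_algebra.
From mathcomp Require Import all_classical all_reals all_analysis.
From mathcomp Require Import measurable_realfun ring lra zify.
Set Implicit Arguments.
Unset Strict Implicit.
Unset Printing Implicit Defensive.
Import Order.TTheory GRing.Theory Num.Theory.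
Import numFieldNormedType.Exports.
Local Open Scope classical_set_scope.
Local Open Scope ring_scope.

(** Let q x u = gam (u - f x), and for a terminal weight psi let F psi x be the
    integral over the future states of the chain started at x of the product of
    the likelihoods and of psi. The filter is U psi / U 1, where U psi is the
    integral of F psi, weighted by the first likelihood, against the initial law.

    Contraction. Two initial laws are compared through the function
    F psi x . F 1 x' - F 1 x . F psi x' of a pair of states. It is antisymmetric,
    so in one step of the recursion the weight q x u . q x' u' can be replaced by
    half of its difference with q x u' . q x' u. If both states are in the set
    C(y_k, D), both new states in C(y_(k+1), D) and the noises are moderate (a good
    transition), the local Doeblin property makes this difference smaller than
    the sum by a factor e^-theta. A state outside C(y_k, D) spoils at most two
    transitions, so costs a factor e^(2 theta), but there the likelihood is below
    M e^-l. With s l = 2 theta, Young's inequality trades one factor for the other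
    ([weighted_pair], [future_contraction]), and the total variation distance is
    at most 2 e^(-theta G) (M^(2n+2) / (Z Z'))^s, with G the number of good
    transitions and Z, Z' the normalizing constants ([tv_gap]).

    Lower bound. By E1 the trajectories that remain in C(Y_k, Delta) have
    transition densities at least e^-Z_k, so Z is at least the product of the
    initial integral V = nu g Q 1_C and of factors c e^-Z_k ([unnorm_ge]). Hence
    the distance is at most a constant times (V V')^-s times a product of
    factors e^(-theta good_k + s (c' + 2 Z_k)) ([path_tv_bound]).

    Expectation. The k-th factor is a function of eps_(k-1), zeta_k, eps_k, whose
    law does not depend on k. Since s = 2 theta / l, its exponent is theta times
    -good_k + 2 (c' + 2 Z_k) / l; first l is chosen large, then the good set, which
    makes its mean negative, and for theta small the fourth power of the factor
    has expectation at most e^(-3 theta) ([step_moment]). Factors of the same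
    parity are independent, so two uses of the inequality between geometric and
    arithmetic means, one to separate the parities ([integral_prod_sqr]) and one to
    separate V and V', whose negative powers of small order are integrable, show
    that the expected distance decays exponentially ([exponential_bound]). *)

(** * Borel sets of row vectors *)

Section borel_row.
Context {R : realType}.

Lemma measurable_coord n (i : 'I_n) :
  measurable_fun setT (fun x : 'rV[R]_n => x ord0 i).
Proof.
apply: (measurability (@RGenOInfty.G R)) => [|/= _ [_] [r] -> <-].
  exact: RGenOInfty.measurableE.
rewrite setTI; apply: sub_sigma_algebra.
apply: open_comp => [x _|]; last exact: interval_open.
exact: coord_continuous.
Qed.

(** An open set is a countable union of rational cubes, so the coordinates
    generate the Borel sigma-field. *)
Lemma measurable_to_row d (T : measurableType d) n (g : T -> 'rV[R]_n) :
  (forall i, measurable_fun setT (fun t => g t ord0 i)) ->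
  measurable_fun setT g.
Proof.
move=> mg; apply: (measurability [set A : set 'rV[R]_n | open A]) => //.
move=> /= _ [U oU <-]; rewrite setTI.
pose box (qk : 'rV[rat]_n * nat) : set 'rV[R]_n :=
  [set x | forall i, `|ratr (qk.1 ord0 i) - x ord0 i| < qk.2.+1%:R^-1].
have -> : g @^-1` U =
    \bigcup_(qk in [set qk | box qk `<=` U]) (g @^-1` box qk).
  apply/seteqP; split => [t /= Ut|t [qk /= bU]]; last exact: bU.
  have /nbhs_ballP[e /= e0 eU] : nbhs (g t) U by exact: open_nbhs_nbhs.
  have [k ke] : exists k : nat, k.+1%:R^-1 < e / 2.
    have [k _ /(_ k (leqnn k))] := near_infty_natSinv_lt (PosNum (divr_gt0 e0 (ltr0n R 2))).
    by exists k.
  have q_ i : {q : rat | `|ratr q - g t ord0 i| < k.+1%:R^-1}.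
    have : g t ord0 i - k.+1%:R^-1 < g t ord0 i + k.+1%:R^-1.
      by rewrite ltrBlDr -addrA ltrDl addr_gt0.
    move=> /rat_in_itvoo/cid[q]; rewrite in_itv/= => /andP[q1 q2].
    by exists q; rewrite ltr_norml; apply/andP; split; move: q1 q2; set u := _^-1; lra.
  exists (\row_i sval (q_ i), k).
    move=> x bx; apply: eU; split => // i j; rewrite (ord1 i) /ball /=.
    have := bx j; rewrite /= mxE; case: (q_ j) => q /= q1 q2.
    rewrite (le_lt_trans (ler_distD (ratr q) _ _))// (splitr e) ltrD//.
      by rewrite distrC (lt_trans q1).
    exact: lt_trans q2 _.
  by move=> i /=; rewrite mxE; case: (q_ i).
rewrite bigcup_mkcond; apply: countable_bigcupT_measurable => [|qk].
  exact: countableP.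
case: ifPn => // _.
rewrite (_ : _ @^-1` _ = \bigcap_(i in [set: 'I_n])
  ((fun t => g t ord0 i) @^-1` (ball (ratr (qk.1 ord0 i) : R) qk.2.+1%:R^-1))).
  apply: fin_bigcap_measurable => // i _; rewrite -[X in measurable X]setTI.
  by apply: mg => //; exact: measurable_ball.
apply/seteqP; split => t /= tb i; first by move=> _; exact: tb.
exact: tb.
Qed.

End borel_row.

(** * Lebesgue measure on R^n *)

Section lebesgue_row.
Context {R : realType}.
Local Open Scope ereal_scope.

(** The parametrization of R^(n+1) by R x R^n used in [lebesgue_rV], and its
    inverse. *)
Definition consrow n (tv : measurableTypeR R * 'rV[R]_n) : 'rV[R]_n.+1 :=
  row_mx (tv.1)%:M tv.2 : 'rV[R]_(1 + n).

Definition unconsrow n (x : 'rV[R]_n.+1) : measurableTypeR R * 'rV[R]_n :=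
  (x ord0 ord0, @rsubmx R 1 1 n x).

Lemma consrow0 n tv : @consrow n tv ord0 ord0 = tv.1.
Proof.
have := row_mxEl (tv.1)%:M tv.2 (ord0 : 'I_1) (ord0 : 'I_1).
by rewrite lshift0 [(_%:M : _) _ _]mxE eqxx mulr1n => <-.
Qed.

Lemma consrowS n tv j : @consrow n tv ord0 (lift ord0 j) = tv.2 ord0 j.
Proof.
by have := row_mxEr (tv.1)%:M tv.2 (ord0 : 'I_1) j; rewrite rshift1.
Qed.

Lemma unconsrowS n x j : (@unconsrow n x).2 ord0 j = x ord0 (lift ord0 j).
Proof. by rewrite /unconsrow /= mxE -rshift1. Qed.

Lemma consrowK n : cancel (@consrow n) (@unconsrow n).
Proof.
move=> [t v]; congr (_, _); first by rewrite consrow0.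
by apply/rowP => j; have := unconsrowS (consrow (t, v)) j; rewrite /= => ->; rewrite consrowS.
Qed.

Lemma measurable_consrow n : measurable_fun setT (@consrow n).
Proof.
apply: measurable_to_row => i; case: (unliftP ord0 i) => [j|] ->.
  under eq_fun do rewrite consrowS.
  exact: (measurableT_comp (measurable_coord j) measurable_snd).
by under eq_fun do rewrite consrow0; exact: measurable_fst.
Qed.

Lemma measurable_unconsrow n : measurable_fun setT (@unconsrow n).
Proof.
apply: measurable_fun_pair; first exact: measurable_coord.
apply: measurable_to_row => i.
have -> : (fun t => @rsubmx R 1 1 n t ord0 i) = fun t => t ord0 (lift ord0 i).
  by apply/funext => t; rewrite -unconsrowS.
exact: measurable_coord.
Qed.

(** A copy of [mu] on which the sigma-finite structure can be declared. *)
Definition as_sigma_finite d (T : measurableType d)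
    (mu : {measure set T -> \bar R}) of sigma_finite setT mu :
  set T -> \bar R := mu.

HB.instance Definition _ d (T : measurableType d)
    (mu : {measure set T -> \bar R}) (sf : sigma_finite setT mu) :=
  Measure.on (as_sigma_finite sf).

HB.instance Definition _ d (T : measurableType d)
    (mu : {measure set T -> \bar R}) (sf : sigma_finite setT mu) :=
  Measure_isSigmaFinite.Build _ _ _ (as_sigma_finite sf) sf.

(** The structure is found by induction on n: dimension n has to be known to be
    sigma-finite before the product that defines dimension n.+1 is a measure. *)
Lemma lebesgue_rV_sigma_finite_measure n :
  exists m : {sigma_finite_measure set 'rV[R]_n -> \bar R}, @lebesgue_rV R n = m.
Proof.
elim: n => [|n [m IH]]; first by exists (\d_(0 : 'rV[R]_0))%R.
pose pf : {measure set 'rV[R]_n.+1 -> \bar R} :=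
  pushforward (lebesgue_measure \x m) (@consrow n).
pose m2 := pf (@measurable_consrow n).
have E : @lebesgue_rV R n.+1 = m2 by rewrite /= IH.
have sf : sigma_finite setT m2.
  have /sigma_finiteP[F [TF ndF Foo]] := sigma_finiteT (@lebesgue_measure R).
  have /sigma_finiteP[G [TG ndG Goo]] := sigma_finiteT m.
  exists (fun k => @unconsrow n @^-1` (F k `*` G k)).
    apply/seteqP; split => // x _.
    have : setT (unconsrow x).1 by [].
    have : setT (unconsrow x).2 by [].
    rewrite {1}TF {1}TG => -[k _ Gk] [l _ Fl]; exists (maxn k l) => //; split.
    - by move: Fl; apply/subsetPset/ndF/leq_maxr.
    - by move: Gk; apply/subsetPset/ndG/leq_maxl.
  move=> k; have [mF lF] := Foo k; have [mG lG] := Goo k; split.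
    rewrite -[X in measurable X]setTI; apply: measurable_unconsrow => //.
    exact: measurableX.
  rewrite /m2 /pf /= /pushforward -comp_preimage (_ : _ \o _ = id); last first.
    by apply/funext => tv /=; rewrite consrowK.
  by rewrite preimage_id product_measure1E// lte_mul_pinfty// ge0_fin_numE.
by exists (as_sigma_finite sf).
Qed.

Let lebesgue_rV0 n : @lebesgue_rV R n set0 = 0.
Proof. by have [m ->] := lebesgue_rV_sigma_finite_measure n. Qed.

Let lebesgue_rV_ge0 n A : 0 <= @lebesgue_rV R n A.
Proof. by have [m ->] := lebesgue_rV_sigma_finite_measure n. Qed.

Let lebesgue_rV_additive n : semi_sigma_additive (@lebesgue_rV R n).
Proof.
have [m ->] := lebesgue_rV_sigma_finite_measure n.
exact: measure_semi_sigma_additive.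
Qed.

HB.instance Definition _ n := isMeasure.Build _ _ _ (@lebesgue_rV R n)
  (@lebesgue_rV0 n) (@lebesgue_rV_ge0 n) (@lebesgue_rV_additive n).

Let lebesgue_rV_sigma_finite n : sigma_finite setT (@lebesgue_rV R n).
Proof.
have [m E] := lebesgue_rV_sigma_finite_measure n.
have [F FT Foo] := sigma_finiteT m; exists F => // k.
by rewrite E.
Qed.

HB.instance Definition _ n := Measure_isSigmaFinite.Build _ _ _
  (@lebesgue_rV R n) (@lebesgue_rV_sigma_finite n).

Lemma integral_lebesgue_rVS n (G : 'rV[R]_n.+1 -> \bar R) :
  measurable_fun setT G -> (forall x, 0 <= G x) ->
  \int[@lebesgue_rV R n.+1]_x G x =
  \int[lebesgue_measure]_t \int[@lebesgue_rV R n]_v G (consrow (t, v)).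
Proof.
move=> mG G0.
rewrite (_ : @lebesgue_rV R n.+1 =
  pushforward (lebesgue_measure \x @lebesgue_rV R n) (@consrow n))//.
rewrite (ge0_integral_pushforward (@measurable_consrow n))//.
rewrite preimage_setT fubini_tonelli1//=.
exact: measurableT_comp mG (@measurable_consrow n).
Qed.

(** The translated measure and Lebesgue measure agree on half-open intervals. *)
Lemma lebesgue_integral_shift (G : R -> \bar R) (c : R) :
  measurable_fun setT G -> (forall x, 0 <= G x) ->
  \int[lebesgue_measure]_t G (t + c)%R = \int[lebesgue_measure]_t G t.
Proof.
move=> mG G0.
pose sh := (fun t : measurableTypeR R => (t + c)%R : measurableTypeR R).
have msh : measurable_fun setT sh by apply: measurable_funD.
pose pf : {measure set (measurableTypeR R) -> \bar R} :=
  pushforward lebesgue_measure sh.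
transitivity (\int[pf msh]_t G t).
  by rewrite (ge0_integral_pushforward msh)// => x _; exact: G0.
apply: eq_measure_integral => A mA _; apply/esym.
apply: lebesgue_measure_unique => // _ [[x y] /= _ <-].
rewrite /= /pushforward.
have -> : sh @^-1` `]x, y] = `](x - c)%R, (y - c)%R]%classic.
  by apply/seteqP; split => t; rewrite /= !in_itv /= /sh; lra.
rewrite !lebesgue_measure_itv /= !lte_fin ltrD2r -!EFinB; case: ifP => // _; congr EFin; ring.
Qed.

Lemma consrowD n (tv : measurableTypeR R * 'rV[R]_n) (c : 'rV[R]_n.+1) :
  (consrow tv + c = consrow (tv.1 + (unconsrow c).1, tv.2 + (unconsrow c).2))%R.
Proof.
apply/rowP => i; rewrite mxE; case: (unliftP ord0 i) => [j|] ->.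
  by rewrite !consrowS mxE unconsrowS.
by rewrite !consrow0.
Qed.

Lemma measurable_addrow n (c : 'rV[R]_n) :
  measurable_fun setT (fun x : 'rV[R]_n => (x + c)%R).
Proof.
apply: measurable_to_row => i; under eq_fun do rewrite mxE.
by apply: measurable_funD => //; exact: measurable_coord.
Qed.

(** Tonelli reduces translation invariance to the one-dimensional case. *)
Lemma lebesgue_rV_integral_shift n (G : 'rV[R]_n -> \bar R) (c : 'rV[R]_n) :
  measurable_fun setT G -> (forall x, 0 <= G x) ->
  \int[@lebesgue_rV R n]_x G (x + c)%R = \int[@lebesgue_rV R n]_x G x.
Proof.
elim: n => [|n IH] in G c * => mG G0.
  by apply: eq_integral => x _; congr G; rewrite (thinmx0 c) addr0.
have mGc : measurable_fun setT (fun x : 'rV[R]_n.+1 => G (x + c)%R).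
  by apply: measurableT_comp => //; exact: measurable_addrow.
rewrite (integral_lebesgue_rVS mG G0) (integral_lebesgue_rVS mGc (fun=> G0 _)).
pose H t := \int[@lebesgue_rV R n]_v G (consrow (t, v)).
have mGcons : measurable_fun setT (G \o @consrow n).
  exact: measurableT_comp mG (@measurable_consrow n).
rewrite -(@lebesgue_integral_shift H (unconsrow c).1); last 2 first.
- by have := @measurable_fun_fubini_tonelli_F _ _ _ _ _ (@lebesgue_rV R n) _ mGcons (fun=> G0 _).
- by move=> t; apply: integral_ge0.
apply: eq_integral => t _; under eq_integral do rewrite consrowD /=.
apply: (IH (fun v => G (consrow (_, v)))) => //.
exact: (measurableT_comp mGcons (pair1_measurable _)).
Qed.

Definition cube n (c : 'rV[R]_n) (r : R) : set 'rV[R]_n :=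
  [set x | forall i, ball (c ord0 i) r (x ord0 i)].

Lemma measurable_cube n (c : 'rV[R]_n) (r : R) : measurable (cube c r).
Proof.
rewrite (_ : cube c r = \bigcap_(i in [set: 'I_n])
    ((fun x : 'rV[R]_n => x ord0 i) @^-1` (ball (c ord0 i) r))).
  apply: fin_bigcap_measurable => // i _; rewrite -[X in measurable X]setTI.
  by apply: measurable_coord => //; exact: measurable_ball.
by apply/seteqP; split => x xc i; [move=> _|]; exact: xc.
Qed.

Lemma lebesgue_rV_cube n (c : 'rV[R]_n) (r : R) : (0 < r)%R ->
  @lebesgue_rV R n (cube c r) = ((r *+ 2) ^+ n)%:E.
Proof.
move=> r0; elim: n => [|n IH] in c *.
  by rewrite expr0 /= diracE mem_set// => -[].
have E : (@consrow n) @^-1` cube c r =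
    ball (unconsrow c).1 r `*` cube (unconsrow c).2 r.
  apply/seteqP; split => -[t v] /=.
    move=> tv; split=> [|i]; first by have := tv ord0; rewrite consrow0.
    by have := tv (lift ord0 i); rewrite consrowS unconsrowS.
  move=> [t1 v1] i; case: (unliftP ord0 i) => [j|] ->.
    by rewrite consrowS -unconsrowS; exact: v1.
  by rewrite consrow0.
transitivity (lebesgue_measure (ball (unconsrow c).1 r) *
    @lebesgue_rV R n (cube (unconsrow c).2 r)).
  rewrite [LHS]/= /pushforward E product_measure1E//.
    exact: measurable_ball.
  exact: measurable_cube.
by rewrite IH lebesgue_measure_ball ?ltW// exprS.
Qed.

End lebesgue_row.

(** * Integration against a density *)

Section density_integral.
Context d (T : measurableType d) (R : realType) (mu : {measure set T -> \bar R}).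
Variable q : T -> R.
Local Open Scope ereal_scope.
Import HBNNSimple.

Definition with_density (A : set T) : \bar R := \int[mu]_(u in A) (q u)%:E.

Hypotheses (mq : measurable_fun setT q) (q0 : forall u, (0 <= q u)%R).

Let mqE : measurable_fun setT (fun u => (q u)%:E).
Proof. exact/measurable_EFinP. Qed.

Let with_density0 : with_density set0 = 0.
Proof. exact: integral_set0. Qed.

Let with_density_ge0 A : 0 <= with_density A.
Proof. by apply: integral_ge0 => u _; rewrite lee_fin. Qed.

Let with_density_additive : semi_sigma_additive with_density.
Proof.
move=> F mF tF mUF; rewrite /with_density ge0_integral_bigcup//.
- by apply: is_cvg_nneseries => n _ _; exact: with_density_ge0.
- exact: measurable_funTS.
- by move=> u _; rewrite lee_fin.
Qed.

HB.instance Definition _ := isMeasure.Build _ _ _ with_density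
  with_density0 with_density_ge0 with_density_additive.

(** Both sides agree on simple functions, and both are continuous along
    increasing sequences. *)
Lemma integral_with_density (F : T -> \bar R) :
  measurable_fun setT F -> (forall u, 0 <= F u) ->
  \int[with_density]_u F u = \int[mu]_u ((q u)%:E * F u).
Proof.
move=> mF F0; pose F_ := nnsfun_approx measurableT mF.
have mF_ n : measurable_fun setT (fun u : T => (F_ n u)%:E).
  exact/measurable_EFinP.
have ndF_ u : {homo (fun n => (F_ n u)%:E) : m n / (m <= n)%N >-> m <= n}.
  by move=> m n mn; rewrite lee_fin; exact/lefP/nd_nnsfun_approx.
have cF_ u : (F_ n u)%:E @[n --> \oo] --> F u.
  by apply: cvg_nnsfun_approx.
transitivity (limn (fun n => \int[with_density]_u (F_ n u)%:E)).
  rewrite -monotone_convergence//.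
  - by apply: eq_integral => u _; apply/esym/cvg_lim.
  - by move=> n u _; rewrite lee_fin.
have -> : \int[mu]_u ((q u)%:E * F u) =
    limn (fun n => \int[mu]_u ((q u)%:E * (F_ n u)%:E)).
  rewrite -monotone_convergence//.
  - apply: eq_integral => u _; apply/esym/cvg_lim => //.
    by apply: cvgeZl.
  - by move=> n; apply: emeasurable_funM.
  - by move=> n u _; rewrite mule_ge0// lee_fin.
  - by move=> u _ m n /ndF_ mn; rewrite lee_wpmul2l// lee_fin.
congr (limn _); apply/funext => n.
transitivity (\sum_(k \in range (F_ n)) k%:E * with_density (F_ n @^-1` [set k])).
  by rewrite integralT_nnsfun sintegralE.
transitivity (\int[mu]_u \sum_(k \in range (F_ n))
    (k%:E * ((\1_(F_ n @^-1` [set k]) u)%:E * (q u)%:E))).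
  rewrite ge0_integral_fsum//; last 2 first.
  - move=> k; apply: emeasurable_funM => //; apply: emeasurable_funM => //.
    exact/measurable_EFinP/measurable_indic.
  - move=> k u _.
    have [k0|k0] := leP 0%R k.
      by rewrite !mule_ge0// lee_fin.
    rewrite preimage_nnfun0// indic0 mul0e mule0 //.
  apply: eq_fsbigr => k _.
  have [k0|k0] := leP 0%R k; last first.
    rewrite preimage_nnfun0// /with_density integral_set0 mule0.
    by rewrite integral0_eq// => u _; rewrite indic0 mul0e mule0.
  rewrite ge0_integralZl_EFin//; last 2 first.
  - by move=> u _; rewrite mule_ge0// lee_fin.
  - by apply: emeasurable_funM => //; exact/measurable_EFinP/measurable_indic.
  congr (_ * _); rewrite /with_density integral_mkcond; apply: eq_integral => u _.
  rewrite patchE indicE; case: ifPn => _; first by rewrite mul1e.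
  by rewrite mul0e.
apply: eq_integral => u _.
rewrite [in RHS]fimfunE -fsumEFin// ge0_mule_fsumr; last first.
  by move=> k; rewrite EFinM nnfun_muleindic_ge0.
by apply: eq_fsbigr => k _; rewrite muleA muleC EFinM.
Qed.

End density_integral.

(** * Contraction for pairs of states *)

Section bilinear_integral.
Context d1 d2 (T1 : measurableType d1) (T2 : measurableType d2) (R : realType).
Variables (mu1 : {measure set T1 -> \bar R}) (mu2 : {measure set T2 -> \bar R}).

Lemma integrable_lincomb d (T : measurableType d) (mu : {measure set T -> \bar R})
    (I : Type) (s : seq I) (c : I -> R) (b : I -> T -> R) :
  (forall i, mu.-integrable setT (EFin \o b i)) ->
  mu.-integrable setT (EFin \o (fun u => \sum_(i <- s) c i * b i u)).
Proof.
move=> ib; elim: s => [|i s IH].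
  apply: (eq_integrable _ (cst 0%E)) => //; last exact: integrable0.
  by move=> u _; rewrite /= big_nil.
apply: eq_integrable (integrableD measurableT
  (integrableZl measurableT (c i) (ib i)) IH) => // u _ /=.
by rewrite big_cons EFinD EFinM.
Qed.

Lemma Rintegral_lincomb d (T : measurableType d) (mu : {measure set T -> \bar R})
    (I : Type) (s : seq I) (c : I -> R) (b : I -> T -> R) :
  (forall i, mu.-integrable setT (EFin \o b i)) ->
  \int[mu]_u (\sum_(i <- s) c i * b i u) = \sum_(i <- s) c i * \int[mu]_u b i u.
Proof.
move=> ib; elim: s => [|i s IH].
  rewrite big_nil; under eq_Rintegral do rewrite big_nil.
  by rewrite /Rintegral integral0.
rewrite big_cons -IH -RintegralZl// -RintegralD//.
- by apply: eq_Rintegral => u _; rewrite big_cons.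
- by have := integrableZl measurableT (c i) (ib i).
- exact: integrable_lincomb.
Qed.

(** A pointwise inequality between sums of products of a function of u and a
    function of v can be integrated in v and then in u; this takes the place of
    an integral over the product space in the pair argument below. *)
Lemma bilinear_integral_ge0 (I : Type) (s : seq I) (c : I -> R)
    (a : I -> T1 -> R) (b : I -> T2 -> R) :
  (forall i, mu1.-integrable setT (EFin \o a i)) ->
  (forall i, mu2.-integrable setT (EFin \o b i)) ->
  (forall u v, 0 <= \sum_(i <- s) c i * (a i u * b i v)) ->
  0 <= \sum_(i <- s) c i * (\int[mu1]_u a i u * \int[mu2]_v b i v).
Proof.
move=> ia ib ab0.
have -> : \sum_(i <- s) c i * (\int[mu1]_u a i u * \int[mu2]_v b i v) =
    \int[mu1]_u \sum_(i <- s) (c i * \int[mu2]_v b i v) * a i u.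
  by rewrite Rintegral_lincomb//; apply: eq_bigr => i _; rewrite -mulrA [_ * \int[mu2]_v _]mulrC.
apply: Rintegral_ge0 => u _.
have -> : \sum_(i <- s) (c i * \int[mu2]_v b i v) * a i u =
    \int[mu2]_v \sum_(i <- s) (c i * a i u) * b i v.
  by rewrite Rintegral_lincomb//; apply: eq_bigr => i _; rewrite mulrAC.
apply: Rintegral_ge0 => v _.
by under eq_bigr do rewrite -mulrA.
Qed.

End bilinear_integral.

Section pair_contraction.
Context d (T : measurableType d) (R : realType)
  (mu : {sigma_finite_measure set T -> \bar R}).
Variables (q : T -> T -> R) (g : nat -> T -> R) (M : R).
Hypotheses (q0 : forall x u, 0 <= q x u)
  (mq : measurable_fun setT (fun xu : T * T => q xu.1 xu.2))
  (q1 : forall x, (\int[mu]_u (q x u)%:E = 1)%E)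
  (mg : forall k, measurable_fun setT (g k)) (g0 : forall k u, 0 <= g k u)
  (gM : forall k u, g k u <= M).

Let measurable_q x : measurable_fun setT (q x).
Proof. exact: (measurableT_comp mq (pair1_measurable x)). Qed.

Let integrable_q x : mu.-integrable setT (EFin \o q x).
Proof.
apply/integrableP; split; first exact/measurable_EFinP.
under eq_integral do rewrite /= ger0_norm//.
by rewrite q1 ltry.
Qed.

Lemma integrable_kernel_bounded x (F : T -> R) (K : R) : measurable_fun setT F ->
  (forall u, `|F u| <= K) -> mu.-integrable setT (EFin \o (fun u => q x u * F u)).
Proof.
move=> mF FK.
apply: (@le_integrable _ _ _ mu setT measurableT _
    (fun u => (K%:E * (EFin \o q x) u)%E)) => //.
- by apply/measurable_EFinP; apply: measurable_funM.
- move=> u _ /=; rewrite lee_fin !normrM mulrC ler_wpM2r//.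
  exact: le_trans (FK u) (ler_norm K).
- exact: integrableZl.
Qed.

Lemma measurable_kernel_average (F : T -> R) : measurable_fun setT F ->
  (forall u, 0 <= F u) -> measurable_fun setT (fun x => \int[mu]_u (q x u * F u)).
Proof.
move=> mF F0; apply: measurableT_comp; first exact: fine_measurable.
pose G (xu : T * T) := (q xu.1 xu.2 * F xu.2)%:E.
apply: (@measurable_fun_fubini_tonelli_F _ _ _ _ _ mu G).
  apply/measurable_EFinP; apply: measurable_funM => //.
  exact: measurableT_comp.
by move=> xu; rewrite lee_fin mulr_ge0.
Qed.

Lemma Rintegral_kernel1 x : \int[mu]_u q x u = 1.
Proof. by rewrite /Rintegral q1. Qed.

Lemma integrable_indic_kernel x E : measurable E ->
  mu.-integrable setT (EFin \o (fun u => q x u * \1_E u)).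
Proof.
move=> mE; apply: (@integrable_kernel_bounded _ _ 1); first exact: measurable_indic.
by move=> u; rewrite indicE; case: (u \in E); rewrite ?normr1 ?normr0.
Qed.

Lemma integrable_one_step (nu : probability T R) E : measurable E ->
  nu.-integrable setT
    (EFin \o (fun x => g 0%N x * \int[mu]_u (q x u * \1_E u))).
Proof.
move=> mE; have Q01 x : 0 <= \int[mu]_u (q x u * \1_E u) <= 1.
  apply/andP; split.
    by apply: Rintegral_ge0 => u _; rewrite mulr_ge0.
  rewrite -(Rintegral_kernel1 x); apply: le_Rintegral => //.
    exact: integrable_indic_kernel.
  by move=> u _; rewrite indicE ler_piMr//; case: (u \in _).
apply: measurable_bounded_integrable => //.
- by rewrite (le_lt_trans (probability_le1 _ _))// ltry.
- by apply: measurable_funM => //; exact: measurable_kernel_average.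
exists M; split; first exact: num_real.
move=> x Mx y _; apply: le_trans (ltW Mx).
have /andP[Q0 Q1] := Q01 y.
by rewrite ger0_norm ?mulr_ge0// -[leRHS]mulr1 ler_pM.
Qed.

(** The recursion of [filter_future] for real-valued functions, with [g k] as
    likelihood of the k-th observation. The terminal weight is arbitrary since
    the total variation is reached on sums of indicators. *)
Fixpoint future (psi : T -> R) (k m : nat) (x : T) : R :=
  match m with
  | 0 => psi x
  | m'.+1 => \int[mu]_u (q x u * (g k.+1 u * future psi k.+1 m' u))
  end.

Section bounded_terminal.
Variable psi : T -> R.
Hypotheses (mpsi : measurable_fun setT psi) (psi01 : forall x, 0 <= psi x <= 1).

Lemma future_bounded m k : measurable_fun setT (future psi k m) /\
  forall x, 0 <= future psi k m x <= M ^+ m.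
Proof.
elim: m k => [|m IH] k; first by split.
have [mF F0M] := IH k.+1.
have mgF : measurable_fun setT (fun u => g k.+1 u * future psi k.+1 m u).
  exact: measurable_funM.
have gF0 u : 0 <= g k.+1 u * future psi k.+1 m u.
  by rewrite mulr_ge0//; have /andP[] := F0M u.
have gFM u : g k.+1 u * future psi k.+1 m u <= M ^+ m.+1.
  by rewrite exprS ler_pM//; have /andP[] := F0M u.
split; first exact: measurable_kernel_average.
move=> x; apply/andP; split.
  by apply: Rintegral_ge0 => u _; rewrite mulr_ge0.
rewrite /= -[leRHS]mul1r -(Rintegral_kernel1 x) -RintegralZr//.
apply: le_Rintegral => //.
- by apply: (@integrable_kernel_bounded _ _ (M ^+ m.+1)) => // u; rewrite ger0_norm.
- by have := integrableZr measurableT (M ^+ m.+1) (integrable_q x).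
- by move=> u _; rewrite ler_wpM2l.
Qed.

Lemma measurable_future m k : measurable_fun setT (future psi k m).
Proof. by have [] := future_bounded m k. Qed.

Lemma future_ge0 m k x : 0 <= future psi k m x.
Proof. by have [_ /(_ x)/andP[]] := future_bounded m k. Qed.

Lemma future_le m k x : future psi k m x <= M ^+ m.
Proof. by have [_ /(_ x)/andP[]] := future_bounded m k. Qed.

Lemma integrable_future m k x : mu.-integrable setT
  (EFin \o (fun u => q x u * (g k.+1 u * future psi k.+1 m u))).
Proof.
apply: (@integrable_kernel_bounded _ _ (M ^+ m.+1)).
  by apply: measurable_funM => //; exact: measurable_future.
move=> u; rewrite ger0_norm ?mulr_ge0 ?future_ge0//.
by rewrite exprS ler_pM ?future_ge0 ?future_le.
Qed.

End bounded_terminal.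

Lemma future_sum (I : Type) (t : seq I) (psi : I -> T -> R) m k x :
  (forall i, measurable_fun setT (psi i)) -> (forall i x, 0 <= psi i x <= 1) ->
  future (fun x => \sum_(i <- t) psi i x) k m x = \sum_(i <- t) future (psi i) k m x.
Proof.
move=> mpsi psi01; elim: m k x => [//|m IH] k x /=.
transitivity (\int[mu]_u \sum_(i <- t)
    1 * (q x u * (g k.+1 u * future (psi i) k.+1 m u))).
  apply: eq_Rintegral => u _; rewrite IH !mulr_sumr.
  by apply: eq_bigr => i _; rewrite mul1r.
rewrite Rintegral_lincomb; last by move=> i; exact: integrable_future.
by apply: eq_bigr => i _; rewrite mul1r.
Qed.

(** Two copies of the chain that are both in [C k] and move to [C k.+1] on a good
    transition forget their past by a factor e^-theta; a copy outside [C k] has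
    a likelihood smaller by a factor e^-l. *)
Variables (C : nat -> set T) (good : nat -> bool) (l theta s : R).
Hypotheses (theta0 : 0 <= theta) (s0 : 0 <= s) (s1 : s <= 1)
  (slE : s * l = 2 * theta) (M0 : 0 <= M)
  (g_off : forall k u, ~ C k u -> g k u <= M * expR (- l)).

Local Notation p x x' u u' := (q x u * q x' u').

Hypothesis minorization : forall k x x' u u', good k.+1 ->
  C k x -> C k x' -> C k.+1 u -> C k.+1 u' ->
  `|p x x' u u' - p x x' u' u| <= expR (- theta) * (p x x' u u' + p x x' u' u).

(** A real number because it appears in exponents. *)
Definition miss k x x' : R := if `[< C k x /\ C k x' >] then 0 else 1.

Lemma missC k x x' : miss k x x' = miss k x' x.
Proof. by rewrite /miss (propext (and_comm _ _)). Qed.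

Definition decay (k m : nat) : R :=
  \prod_(k <= j < k + m) (if good j.+1 then expR (- theta) else 1).

Lemma decay_ge0 k m : 0 <= decay k m.
Proof. by apply: prodr_ge0 => j _; case: ifP; rewrite ?expR_ge0. Qed.

(** The coefficients in Young's inequality z^s <= (1 - s) c^s + s c^(s-1) z, with
    c = e^tau. *)
Let cs tau := (1 - s) * expR (s * tau).
Let ce tau := s * expR ((s - 1) * tau).

Let young1 tau : 1 <= cs tau + ce tau.
Proof.
have h1 := expR_ge1Dx (s * tau); have h2 := expR_ge1Dx ((s - 1) * tau).
rewrite /cs /ce.
have e1 : (1 - s) * (1 + s * tau) <= (1 - s) * expR (s * tau).
  by rewrite ler_wpM2l// subr_ge0.
have e2 : s * (1 + (s - 1) * tau) <= s * expR ((s - 1) * tau) by rewrite ler_wpM2l.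
nra.
Qed.

Let cs_ge0 tau : 0 <= cs tau.
Proof. by rewrite mulr_ge0 ?expR_ge0// subr_ge0. Qed.

Let ce_ge0 tau : 0 <= ce tau.
Proof. by rewrite mulr_ge0 ?expR_ge0. Qed.

Let one : T -> R := fun=> 1.
Let mone : measurable_fun setT one. Proof. exact: measurable_cst. Qed.
Let one01 x : 0 <= one x <= 1. Proof. by rewrite /one ler01 lexx. Qed.

Let weight_miss k u u' : g k u * g k u' * expR (l * miss k u u') <= M ^+ 2.
Proof.
rewrite /miss; case: asboolP => [_|].
  by rewrite mulr0 expR0 mulr1 expr2 ler_pM.
have E : M * M = M * (M * expR (- l)) * expR (l * 1).
  by rewrite mulr1 -!mulrA -expRD addNr expR0 mulr1.
move=> /not_andP[]/g_off gl; rewrite expr2 E ler_wpM2r ?expR_ge0//.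
  by rewrite mulrC ler_pM.
by rewrite ler_pM.
Qed.

(** A pair outside [C] spoils the two transitions that surround it: hence the
    loss of e^theta at both ends. *)
Let ratio_miss k x x' u u' :
  `|p x x' u u' - p x x' u' u| <=
  (if good k.+1 then expR (- theta) else 1) *
  expR (theta * miss k x x') * expR (theta * miss k.+1 u u') *
  (p x x' u u' + p x x' u' u).
Proof.
have p0 y y' v v' : 0 <= p y y' v v' by rewrite mulr_ge0.
have trivial_bound : `|p x x' u u' - p x x' u' u| <= p x x' u u' + p x x' u' u.
  by rewrite (le_trans (ler_normB _ _))// !ger0_norm.
case: ifPn => [gk|_].
  rewrite /miss; case: asboolP => [[Cx Cx']|_]; last first.
    apply: (le_trans trivial_bound); rewrite ler_peMl ?addr_ge0//.
    rewrite mulr1 -expRD addNr expR0 mul1r -expR0 ler_expR mulr_ge0//.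
    by case: asboolP.
  rewrite mulr0 expR0 mulr1; case: asboolP => [[Cu Cu']|_].
    by rewrite mulr0 expR0 mulr1; exact: (@minorization k).
  by rewrite mulr1 -expRD addNr expR0 mul1r.
apply: (le_trans trivial_bound); rewrite ler_peMl ?addr_ge0//.
rewrite mul1r -expRD -expR0 ler_expR -mulrDr mulr_ge0// addr_ge0// /miss;
  by case: asboolP.
Qed.

Let csD tau k u u' : cs (tau - l * miss k u u') =
  cs tau * expR (- (2 * theta * miss k u u')).
Proof.
rewrite /cs -mulrA -expRD mulrBr; congr (_ * expR (_ - _)).
by rewrite mulrA slE.
Qed.

Let ceD tau k u u' : ce (tau - l * miss k u u') =
  ce tau * (expR (l * miss k u u') * expR (- (2 * theta * miss k u u'))).
Proof. by rewrite /ce -mulrA -!expRD -slE; congr (_ * expR _); ring. Qed.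

(** The free parameter [tau] accounts for the pairs outside [C k]: when it is
    shifted by l, the term with coefficient [cs] gains e^(-s l) = e^(-2 theta),
    which pays for the two spoiled transitions; the term with coefficient [ce]
    loses e^((1 - s) l), so e^l together with the spoiled transitions, which the
    smaller likelihood pays for. *)
Lemma weighted_pair k u u' tau (D F B r : R) : 0 <= r -> 0 <= B ->
  (forall tau, D <= r * expR (theta * miss k u u') * (cs tau * F + ce tau * B)) ->
  expR (theta * miss k u u') * (g k u * g k u' * D) <=
  r * (cs tau * (g k u * g k u' * F) + ce tau * (M ^+ 2 * B)).
Proof.
move=> r0 B0 /(_ (tau - l * miss k u u')); rewrite csD ceD => DB.
set e := expR (theta * _) in DB *; set e' := expR (- _) in DB.
have ee : e * e * e' = 1.
  by rewrite /e /e' -!expRD -[RHS]expR0; congr expR; ring.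
have gg0 : 0 <= g k u * g k u' by rewrite mulr_ge0.
apply: (@le_trans _ _ (e * (g k u * g k u' *
   (r * e * (cs tau * e' * F + ce tau * (expR (l * miss k u u') * e') * B))))).
  by rewrite ler_wpM2l ?expR_ge0// ler_wpM2l.
rewrite [leLHS](_ : _ = (e * e * e') * (r * (cs tau * (g k u * g k u' * F) +
   ce tau * (g k u * g k u' * expR (l * miss k u u') * B)))); last by ring.
rewrite ee mul1r ler_wpM2l// lerD2l ler_wpM2l//.
by rewrite ler_wpM2r//; exact: weight_miss.
Qed.

(** The left-hand side is antisymmetric in the pair (x, x'), so one step of the
    recursion may weight the pair (u, u') by half of the difference between the
    two ways of matching (x, x') with (u, u'). On a good transition this
    difference is smaller than the sum by a factor e^-theta, and half of the sum
    integrates to the same value as the original weight. *)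
Lemma future_contraction (psi : T -> R) : measurable_fun setT psi ->
  (forall x, 0 <= psi x <= 1) -> forall m k x x' tau,
  future psi k m x * future one k m x' - future one k m x * future psi k m x' <=
  decay k m * expR (theta * miss k x x') *
  (cs tau * (future one k m x * future one k m x') + ce tau * M ^+ (2 * m)).
Proof.
move=> mpsi psi01; elim=> [|m IH] k x x' tau.
  rewrite /decay addn0 big_geq// mul1r muln0 expr0 !mulr1 mul1r /= /one.
  have /andP[y0 y1] := psi01 x; have /andP[y0' y1'] := psi01 x'.
  apply: (@le_trans _ _ 1); first lra.
  apply: (le_trans (young1 tau)); rewrite ler_peMl ?addr_ge0//.
  by rewrite -expR0 ler_expR mulr_ge0// /miss; case: asboolP.
set gp := fun u => g k.+1 u * future psi k.+1 m u.
set go := fun u => g k.+1 u * future one k.+1 m u.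
(* The factors of the products in the pointwise inequality, so that it becomes
   an instance of [bilinear_integral_ge0]. *)
pose phi (i : nat) : T -> R := match i with
  | 0%N => fun u => q x u | 1%N => fun u => q x' u
  | 2%N => fun u => q x u * gp u | 3%N => fun u => q x' u * gp u
  | 4%N => fun u => q x u * go u | _ => fun u => q x' u * go u end.
have iphi i : mu.-integrable setT (EFin \o phi i).
  move: i => [|[|[|[|[|i]]]]]; rewrite /phi.
  - exact: integrable_q.
  - exact: integrable_q.
  - exact: (integrable_future mpsi psi01).
  - exact: (integrable_future mpsi psi01).
  - exact: (integrable_future mone one01).
  - exact: (integrable_future mone one01).
set kap := decay k m.+1 * _.
set B := M ^+ (2 * m.+1).
pose S : seq (R * nat * nat) := [::
  (kap * cs tau, 4%N, 5%N); (kap * cs tau, 5%N, 4%N);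
  (kap * ce tau * B, 0%N, 1%N); (kap * ce tau * B, 1%N, 0%N);
  (- 1, 2%N, 5%N); (1, 4%N, 3%N); (1, 3%N, 4%N); (- 1, 5%N, 2%N)].
have := @bilinear_integral_ge0 _ _ _ _ _ mu mu _ S (fun t => t.1.1)
  (fun t => phi t.1.2) (fun t => phi t.2)
  (fun=> iphi _) (fun=> iphi _).
rewrite /S !big_cons big_nil /= !Rintegral_kernel1.
set i1 := \int[mu]_u _; set i2 := \int[mu]_u _; set i3 := \int[mu]_u _.
set i4 := \int[mu]_u _.
move=> bil.
have {}bil : 0 <= 2 * (kap * (cs tau * (i1 * i2) + ce tau * B) - (i3 * i2 - i1 * i4)).
  rewrite [leRHS](_ : _ =
   kap * cs tau * (i1 * i2) +
     (kap * cs tau * (i2 * i1) +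
      (kap * ce tau * B * (1 * 1) +
       (kap * ce tau * B * (1 * 1) +
        (-1 * (i3 * i2) + (1 * (i1 * i4) + (1 * (i4 * i1) + (-1 * (i2 * i3) + 0)))))))); last by ring.
  apply: bil => u v; rewrite !big_cons big_nil /=.
  set Fu := future one k.+1 m u; set Fv := future one k.+1 m v.
  set D := future psi k.+1 m u * Fv - Fu * future psi k.+1 m v.
  set X := decay k.+1 m * (cs tau * (g k.+1 u * g k.+1 v * (Fu * Fv)) +
    ce tau * (M ^+ 2 * M ^+ (2 * m))).
  have Bm0 : 0 <= M ^+ (2 * m) by rewrite exprn_ge0.
  have XD : expR (theta * miss k.+1 u v) * (g k.+1 u * g k.+1 v * D) <= X.
    apply: weighted_pair => // [|t]; [exact: decay_ge0|exact: IH].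
  have XND : expR (theta * miss k.+1 u v) * (g k.+1 u * g k.+1 v * - D) <= X.
    apply: weighted_pair => // [|t]; first exact: decay_ge0.
    rewrite (_ : - D = future psi k.+1 m v * Fu - Fv * future psi k.+1 m u).
      by rewrite missC [Fu * Fv]mulrC; exact: IH.
    by rewrite /D; ring.
  have {XD XND}XD : expR (theta * miss k.+1 u v) * `|g k.+1 u * g k.+1 v * D| <= X.
    have [_|_] := ger0P (g k.+1 u * g k.+1 v * D); first exact: XD.
    by rewrite -mulrN.
  have P0 : 0 <= p x x' u v + p x x' v u by rewrite addr_ge0// mulr_ge0.
  rewrite [leRHS](_ : _ = (p x x' u v + p x x' v u) *
     (kap * (cs tau * (go u * go v) + ce tau * B)) -
     (p x x' u v - p x x' v u) * (g k.+1 u * g k.+1 v * D)); last first.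
    by rewrite /gp /go /D /Fu /Fv; ring.
  rewrite subr_ge0 (le_trans (ler_norm _))// normrM.
  apply: (le_trans (ler_wpM2r (normr_ge0 _) (ratio_miss k x x' u v))).
  set G := if _ then _ else _.
  have G0 : 0 <= G by rewrite /G; case: ifP; rewrite ?expR_ge0.
  have kapE : kap = G * expR (theta * miss k x x') * decay k.+1 m.
    rewrite /kap /decay addnS big_ltn ?ltnS ?leq_addr// -/G addSn.
    by rewrite mulrAC.
  rewrite [leRHS](_ : _ = G * expR (theta * miss k x x') *
    (p x x' u v + p x x' v u) * X); last first.
    have BE : B = M ^+ 2 * M ^+ (2 * m) by rewrite /B mulnS exprD.
    rewrite kapE BE /X /go /Fu /Fv; move: (M ^+ (2 * m)) => E; ring.
  rewrite [leLHS](_ : _ = G * expR (theta * miss k x x') *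
    (p x x' u v + p x x' v u) *
    (expR (theta * miss k.+1 u v) * `|g k.+1 u * g k.+1 v * D|)); last by ring.
  by rewrite ler_wpM2l// !mulr_ge0 ?expR_ge0.
by move: bil; rewrite pmulr_rge0// subr_ge0.
Qed.

Definition unnorm (nu : {measure set T -> \bar R}) (psi : T -> R) (n : nat) : R :=
  \int[nu]_x (g 0%N x * future psi 0%N n x).

Lemma integrable_unnorm (nu : probability T R) (psi : T -> R) n :
  measurable_fun setT psi -> (forall x, 0 <= psi x <= 1) ->
  nu.-integrable setT (EFin \o (fun x => g 0%N x * future psi 0%N n x)).
Proof.
move=> mpsi psi01; apply: measurable_bounded_integrable => //.
- by rewrite (le_lt_trans (probability_le1 _ _))// ltry.
- by apply: measurable_funM => //; exact: measurable_future.
exists (M ^+ n.+1); split; first exact: num_real.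
move=> x Mx y _; apply: le_trans (ltW Mx).
rewrite ger0_norm ?mulr_ge0 ?future_ge0//.
by rewrite exprS ler_pM ?future_ge0 ?future_le.
Qed.

Lemma unnorm_sum (nu : probability T R) (I : Type) (t : seq I)
    (psi : I -> T -> R) n :
  (forall i, measurable_fun setT (psi i)) -> (forall i x, 0 <= psi i x <= 1) ->
  unnorm nu (fun x => \sum_(i <- t) psi i x) n = \sum_(i <- t) unnorm nu (psi i) n.
Proof.
move=> mpsi psi01.
transitivity (\int[nu]_x \sum_(i <- t) 1 * (g 0%N x * future (psi i) 0%N n x)).
  apply: eq_Rintegral => x _; rewrite future_sum// mulr_sumr.
  by apply: eq_bigr => i _; rewrite mul1r.
rewrite Rintegral_lincomb; last by move=> i; exact: integrable_unnorm.
by apply: eq_bigr => i _; rewrite mul1r.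
Qed.

Lemma unnorm_contraction (nu nu' : probability T R) (psi : T -> R) n tau :
  measurable_fun setT psi -> (forall x, 0 <= psi x <= 1) ->
  unnorm nu psi n * unnorm nu' one n - unnorm nu one n * unnorm nu' psi n <=
  decay 0%N n * (cs tau * (unnorm nu one n * unnorm nu' one n) +
               ce tau * M ^+ (2 * n.+1)).
Proof.
move=> mpsi psi01.
pose phi (i : nat) : T -> R := match i with
  | 0%N => one | 1%N => fun x => g 0%N x * future psi 0%N n x
  | _ => fun x => g 0%N x * future one 0%N n x end.
have iphi (mu0 : probability T R) i : mu0.-integrable setT (EFin \o phi i).
  move: i => [|[|i]]; rewrite /phi.
  - by apply: finite_measure_integrable_cst.
  - exact: integrable_unnorm.
  - exact: integrable_unnorm.
set B := M ^+ (2 * n.+1).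
pose S : seq (R * nat * nat) := [:: (decay 0%N n * cs tau, 2%N, 2%N);
  (decay 0%N n * ce tau * B, 0%N, 0%N); (- 1, 1%N, 2%N); (1, 2%N, 1%N)].
have one1 (mu0 : probability T R) : \int[mu0]_x one x = 1.
  rewrite /one /Rintegral integral_cst//.
  by rewrite mul1e; exact: (congr1 fine (probability_setT mu0)).
have := @bilinear_integral_ge0 _ _ _ _ _ nu nu' _ S (fun t => t.1.1)
  (fun t => phi t.1.2) (fun t => phi t.2)
  (fun=> iphi _ _) (fun=> iphi _ _).
rewrite /S !big_cons big_nil /= !one1 -!/(unnorm _ _ _).
move=> bil; rewrite -subr_ge0.
rewrite [leRHS](_ : _ = decay 0%N n * cs tau * (unnorm nu one n * unnorm nu' one n) +
   (decay 0%N n * ce tau * B * (1 * 1) +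
    (-1 * (unnorm nu psi n * unnorm nu' one n) +
     (1 * (unnorm nu one n * unnorm nu' psi n) + 0)))); last by ring.
apply: bil => u v; rewrite !big_cons big_nil /= /one.
set Fu := future one 0%N n u; set Fv := future one 0%N n v.
set D := future psi 0%N n u * Fv - Fu * future psi 0%N n v.
set X := decay 0%N n * (cs tau * (g 0%N u * g 0%N v * (Fu * Fv)) +
  ce tau * (M ^+ 2 * M ^+ (2 * n))).
have Bn0 : 0 <= M ^+ (2 * n) by rewrite exprn_ge0.
have XD : expR (theta * miss 0%N u v) * (g 0%N u * g 0%N v * D) <= X.
  apply: weighted_pair => // [|t]; first exact: decay_ge0.
  exact: future_contraction.
have X0 : 0 <= X.
  apply: mulr_ge0; first exact: decay_ge0.
  have Fu0 : 0 <= Fu by exact: future_ge0.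
  have Fv0 : 0 <= Fv by exact: future_ge0.
  apply: addr_ge0; apply: mulr_ge0 => //; apply: mulr_ge0 => //.
  - exact: mulr_ge0.
  - exact: mulr_ge0.
  - exact: exprn_ge0.
have {XD}XD : g 0%N u * g 0%N v * D <= X.
  have [D0|D0] := leP 0 (g 0%N u * g 0%N v * D); last exact: le_trans (ltW D0) X0.
  apply: le_trans XD; rewrite ler_peMl// -expR0 ler_expR mulr_ge0// /miss.
  by case: asboolP.
have BE : B = M ^+ 2 * M ^+ (2 * n) by rewrite /B mulnS exprD.
rewrite [leRHS](_ : _ = X - g 0%N u * g 0%N v * D) ?subr_ge0//.
rewrite /X /D BE -/Fu -/Fv; move: (M ^+ (2 * n)) => E; ring.
Qed.

(** [tau] is chosen to make M^(2n+2) e^-tau equal to the product of the two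
    normalizing constants. *)
Lemma filter_gap (nu nu' : probability T R) (psi : T -> R) n :
  measurable_fun setT psi -> (forall x, 0 <= psi x <= 1) -> 0 < M ->
  0 < unnorm nu one n -> 0 < unnorm nu' one n ->
  unnorm nu psi n / unnorm nu one n - unnorm nu' psi n / unnorm nu' one n <=
  decay 0%N n * expR (s * (ln M *+ (2 * n.+1) - ln (unnorm nu one n) -
                         ln (unnorm nu' one n))).
Proof.
move=> mpsi psi01 M_gt0 Z0 Z0'.
set Z := unnorm nu one n in Z0 *; set Z' := unnorm nu' one n in Z0' *.
set tau := ln M *+ (2 * n.+1) - ln Z - ln Z'.
have ZZ0 : 0 < Z * Z' by rewrite mulr_gt0.
rewrite -(ler_pM2r ZZ0).
rewrite [leLHS](_ : _ = unnorm nu psi n * Z' - Z * unnorm nu' psi n); last first.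
  by field; rewrite !gt_eqF.
apply: (le_trans (unnorm_contraction _ _ _ tau mpsi psi01)); rewrite -/Z -/Z'.
have MZ : M ^+ (2 * n.+1) = expR tau * (Z * Z').
  rewrite /tau -lnXn// -!lnV ?posrE// -!lnM ?posrE ?mulr_gt0 ?invr_gt0 ?exprn_gt0//.
  rewrite lnK ?posrE ?mulr_gt0 ?invr_gt0 ?exprn_gt0//.
  by rewrite [Z * Z']mulrC mulrA !divfK// gt_eqF.
have ce_e : ce tau * expR tau = s * expR (s * tau).
  by rewrite /ce -mulrA -expRD; congr (_ * expR _); ring.
rewrite MZ (_ : cs tau * _ + _ = (cs tau + ce tau * expR tau) * (Z * Z')); last by ring.
by rewrite ce_e /cs -mulrDl subrK mul1r mulrA.
Qed.

(** The sign of each difference splits the partition in two halves, and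
    [filter_gap] applies to each half with the sum of its indicators as terminal
    weight. *)
Lemma tv_gap (nu nu' : probability T R) n m (A : 'I_m -> set T) : 0 < M ->
  (forall i, measurable (A i)) -> trivIset setT A ->
  0 < unnorm nu one n -> 0 < unnorm nu' one n ->
  \sum_(i < m) `|unnorm nu (\1_(A i)) n / unnorm nu one n -
                 unnorm nu' (\1_(A i)) n / unnorm nu' one n| <=
  2 * (decay 0%N n * expR (s * (ln M *+ (2 * n.+1) - ln (unnorm nu one n) -
                                ln (unnorm nu' one n)))).
Proof.
move=> M_gt0 mA tA Z0 Z0'.
set Z := unnorm nu one n in Z0 *; set Z' := unnorm nu' one n in Z0' *.
set bound := decay _ _ * _.
have mI i : measurable_fun setT (\1_(A i) : T -> R) by exact: measurable_indic.
have I01 i x : 0 <= (\1_(A i) : T -> R) x <= 1.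
  by rewrite indicE; case: (x \in A i); rewrite ?lexx ?ler01.
pose psi (S : pred 'I_m) x : R := \sum_(i | S i) \1_(A i) x.
have psiE S : psi S = fun x => \sum_(i <- [seq i <- index_enum _ | S i]) \1_(A i) x.
  by apply/funext => x; rewrite big_filter.
have mpsi S : measurable_fun setT (psi S).
  by rewrite psiE; apply: measurable_sum.
have psi01 S x : 0 <= psi S x <= 1.
  apply/andP; split; first by apply: sumr_ge0 => i _; have /andP[] := I01 i x.
  have [[j /andP[Sj /set_mem Aj]]|noA] := pselect (exists j, S j && (x \in A j)).
    rewrite /psi (bigD1 j)//= big1 ?addr0; first by have /andP[] := I01 j x.
    move=> i /andP[_ ij]; rewrite indicE.
    have [/set_mem Ai|//] := boolP (x \in A i).
    by move: ij; rewrite (tA i j) ?eqxx//; exists x.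
  rewrite /psi big1// => i Si; rewrite indicE.
  have [Ai|//] := boolP (x \in A i).
  by exfalso; apply: noA; exists i; rewrite Si.
have gapS (mu1 mu2 : probability T R) S : 0 < unnorm mu1 one n -> 0 < unnorm mu2 one n ->
    \sum_(i | S i) (unnorm mu1 (\1_(A i)) n / unnorm mu1 one n -
      unnorm mu2 (\1_(A i)) n / unnorm mu2 one n) <=
    decay 0%N n * expR (s * (ln M *+ (2 * n.+1) - ln (unnorm mu1 one n) -
      ln (unnorm mu2 one n))).
  move=> Z1 Z2; have := filter_gap (mpsi S) (psi01 S) M_gt0 Z1 Z2.
  rewrite psiE !unnorm_sum// !big_filter sumrB.
  by rewrite !mulr_suml.
pose dd i := unnorm nu (\1_(A i)) n / Z - unnorm nu' (\1_(A i)) n / Z'.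
rewrite (bigID (fun i => 0 <= dd i))/= mulr_natl mulr2n; apply: lerD.
  rewrite (eq_bigr dd); first exact: gapS.
  by move=> i /ger0_norm.
rewrite (eq_bigr (fun i => unnorm nu' (\1_(A i)) n / Z' -
    unnorm nu (\1_(A i)) n / Z)).
  by have := gapS nu' nu (fun i => ~~ (0 <= dd i)) Z0' Z0; rewrite addrAC.
by move=> i; rewrite -ltNge => /ltr0_norm ->; rewrite opprB.
Qed.

Variables (D : nat -> set T) (kappa : nat -> R) (um : R).
Hypotheses (mD : forall j, measurable (D j)) (kappa0 : forall j, 0 <= kappa j)
  (um0 : 0 <= um) (um_le : forall k u, D k u -> um <= g k u)
  (kappa_le : forall j x, D j x ->
     kappa j.+1 <= \int[mu]_u (q x u * \1_(D j.+1) u)).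

Lemma future_ge_restrict k m x (c : R) : 0 <= c ->
  (forall u, D k.+1 u -> c <= future one k.+1 m u) ->
  um * c * (\int[mu]_u (q x u * \1_(D k.+1) u)) <= future one k m.+1 x.
Proof.
move=> c0 cF; rewrite /= -RintegralZl//; last exact: integrable_indic_kernel.
apply: le_Rintegral => //.
- by have := integrableZl measurableT (um * c)
    (@integrable_indic_kernel x _ (mD k.+1)).
- exact: integrable_future.
move=> u _; rewrite indicE; have [/set_mem Du|_] := boolP (u \in D k.+1).
  rewrite mulr1 mulrC ler_wpM2l// ler_pM//; first exact: um_le.
  exact: cF.
by rewrite !mulr0 mulr_ge0// mulr_ge0// future_ge0.
Qed.

(** The trajectories that stay in the sets [D j] already contribute this much. *)
Lemma future_ge k m x : D k x ->
  \prod_(k <= j < k + m) (um * kappa j.+1) <= future one k m x.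
Proof.
elim: m k x => [|m IH] k x Dx; first by rewrite addn0 big_geq.
set c := \prod_(k.+1 <= j < k.+1 + m) (um * kappa j.+1).
have c0 : 0 <= c by apply: prodr_ge0 => j _; rewrite mulr_ge0.
rewrite addnS big_ltn ?ltnS ?leq_addr// -addSn -/c.
apply: le_trans (@future_ge_restrict k m x c c0 _); last exact: IH.
by rewrite mulrAC ler_wpM2l ?mulr_ge0//; exact: kappa_le.
Qed.

Lemma unnorm_ge (nu : probability T R) n :
  um * (\prod_(1 <= j < n.+1) (um * kappa j.+1)) *
    (\int[nu]_x (g 0%N x * \int[mu]_u (q x u * \1_(D 1%N) u))) <=
  unnorm nu one n.+1.
Proof.
set c := \prod_(1 <= j < n.+1) (um * kappa j.+1).
have c0 : 0 <= c by apply: prodr_ge0 => j _; rewrite mulr_ge0.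
have iQ := integrable_one_step nu (mD 1%N).
rewrite -RintegralZl//; apply: le_Rintegral => //.
- by have := integrableZl measurableT (um * c) iQ.
- exact: integrable_unnorm.
move=> x _; rewrite mulrCA ler_wpM2l//.
by apply: future_ge_restrict => // u Du; exact: future_ge.
Qed.

End pair_contraction.

(** * Independence of generated sigma-fields *)

Section independence_lemmas.
Context d (W : measurableType d) (R : realType) (P : probability W R).
Local Open Scope ereal_scope.

Lemma independent_classesC (G H : set (set W)) :
  independent_classes P G H -> independent_classes P H G.
Proof. by move=> GH A B HA GB; rewrite setIC GH// muleC. Qed.

(** The finite measures B |-> P (A and B) and B |-> P A P B agree on the
    pi-system [H]. *)
Lemma independent_classes_sigma_r (G H : set (set W)) :
  G `<=` measurable -> H `<=` measurable -> setI_closed H -> H setT ->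
  independent_classes P G H -> independent_classes P G <<s H >>.
Proof.
move=> mG mH HI HT GH A B GA sB.
have mA := mG _ GA.
have PA0 : (0 <= fine (P A))%R by rewrite fine_ge0.
pose m1 : {measure set W -> \bar R} := mrestr P mA.
pose m2 : {measure set W -> \bar R} := mscale (NngNum PA0) P.
suff E : m1 B = m2 B.
  have : P (B `&` A) = (fine (P A))%:E * P B := E.
  by rewrite setIC fineK// fin_num_measure.
apply: (g_sigma_algebra_measure_unique H mH (fun=> setT)) => //.
- by rewrite bigcup_const.
- move=> C HC; transitivity (P (C `&` A)) => //.
  rewrite setIC GH//; transitivity ((fine (P A))%:E * P C) => //.
  by rewrite fineK// fin_num_measure.
- move=> _; apply: (@le_lt_trans _ _ 1); last by rewrite ltry.
  by apply: probability_le1; exact: measurableI.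
Qed.

Lemma sub_sigma_measurable (G : set (set W)) :
  G `<=` measurable -> <<s G >> `<=` measurable.
Proof.
move=> mG; apply: smallest_sub => //; exact: sigma_algebra_measurable.
Qed.

Lemma independent_classes_sigma (G H : set (set W)) :
  G `<=` measurable -> H `<=` measurable ->
  setI_closed G -> setI_closed H -> G setT -> H setT ->
  independent_classes P G H -> independent_classes P <<s G >> <<s H >>.
Proof.
move=> mG mH GI HI GT HT GH.
apply/independent_classesC/independent_classes_sigma_r => //.
  exact: sub_sigma_measurable.
exact/independent_classesC/independent_classes_sigma_r.
Qed.

Section family.
Variables (I : choiceType) (E : I -> set (set W)).
Hypotheses (mE : forall i, E i `<=` measurable) (EI : forall i, setI_closed (E i))
  (ET : forall i, E i setT).
Hypothesis indepE : forall (s : seq I) (A : I -> set W), uniq s ->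
  (forall i, E i (A i)) ->
  P (\bigcap_(i in [set` s]) A i) = \prod_(i <- s) P (A i).

Definition sigma_of (s : seq I) : set (set W) :=
  <<s [set A | exists2 i, i \in s & E i A] >>.

Let cyl (s : seq I) : set (set W) :=
  [set B | exists2 A, (forall i, E i (A i)) & B = \bigcap_(i in [set` s]) A i].

Let cylI s : setI_closed (cyl s).
Proof.
move=> _ _ [A EA ->] [B EB ->]; exists (fun i => A i `&` B i).
  by move=> i; exact: EI.
by rewrite bigcapI.
Qed.

Let cylT s : cyl s setT.
Proof. by exists (fun=> setT) => //; rewrite bigcapT. Qed.

Let mcyl s : cyl s `<=` measurable.
Proof.
move=> _ [A EA ->]; apply: fin_bigcap_measurable; first exact: finite_seq.
by move=> i _; exact: mE (EA i).
Qed.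

Let sigma_cyl s : sigma_of s `<=` <<s cyl s >>.
Proof.
apply: smallest_sub; first exact: smallest_sigma_algebra.
move=> A [i si EA]; apply: (@sub_sigma_algebra _ _ (cyl s)).
exists (fun j => if j == i then A else setT).
  by move=> j; case: eqP => [->|].
apply/seteqP; split => [w Aw j _|w /(_ i si)]; first by case: ifP.
by rewrite eqxx.
Qed.

(** The cylinders over [s] and those over [t] are pi-systems that generate the two
    sigma-fields, and their independence is a case of [indepE]. *)
Lemma sigma_of_independent s t : uniq (s ++ t) ->
  independent_classes P (sigma_of s) (sigma_of t).
Proof.
move=> ust; have := ust; rewrite cat_uniq => /and3P[us /hasPn st ut].
suff h : independent_classes P (cyl s) (cyl t).
  have := independent_classes_sigma (@mcyl s) (@mcyl t) (@cylI s) (@cylI t)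
    (cylT s) (cylT t) h.
  by move=> H A B /sigma_cyl sA /sigma_cyl sB; exact: H.
move=> _ _ [A EA ->] [B EB ->].
pose D i := if i \in s then A i else B i.
have DA : \bigcap_(i in [set` s]) A i = \bigcap_(i in [set` s]) D i.
  by apply: eq_bigcapr => i /= si; rewrite /D si.
have DB : \bigcap_(i in [set` t]) B i = \bigcap_(i in [set` t]) D i.
  apply: eq_bigcapr => i /= ti; rewrite /D ifN//; exact: st.
have ED i : E i (D i) by rewrite /D; case: ifP.
rewrite DA DB !indepE// -big_cat -indepE//; congr (P _).
apply/seteqP; split => [w [wA wB] i /=|w H].
  by rewrite mem_cat => /orP[/wA|/wB].
by split => i /= i_; apply: H; rewrite /= mem_cat i_ ?orbT.
Qed.

End family.

End independence_lemmas.

(** * Expectations of products of independent variables *)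

Section joint_law.
Context d (W : measurableType d) (R : realType) (P : probability W R).
Context d1 d2 (T1 : measurableType d1) (T2 : measurableType d2).
Variables (U : {RV P >-> T1}) (V : {RV P >-> T2}).
Local Open Scope ereal_scope.
Hypothesis indepUV : forall A B, measurable A -> measurable B ->
  P (U @^-1` A `&` V @^-1` B) = P (U @^-1` A) * P (V @^-1` B).

(** By independence the joint law and the product of the marginal laws agree on
    rectangles, hence everywhere. *)
Lemma integral_joint_law (G : T1 * T2 -> \bar R) :
  measurable_fun setT G -> (forall x, 0 <= G x) ->
  \int[P]_w G (U w, V w) =
  \int[distribution P U]_x \int[distribution P V]_y G (x, y).
Proof.
move=> mG G0.
have mUV : measurable_fun setT (fun w => (U w, V w)) by exact: measurable_fun_pair.
pose pf : {measure set (T1 * T2)%type -> \bar R} :=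
  pushforward P (fun w => (U w, V w)).
transitivity (\int[pf mUV]_z G z).
  by rewrite (ge0_integral_pushforward mUV)// => z _; exact: G0.
rewrite -fubini_tonelli1//.
apply: eq_measure_integral => A mA _; apply/esym.
by apply: product_measure_unique => // B C mB mC.
Qed.

End joint_law.

Section product_expectation.
Context d (W : measurableType d) (R : realType) (P : probability W R).
Variables (U V : {RV P >-> R}).
Local Open Scope ereal_scope.
Hypotheses (U0 : forall w, (0 <= U w)%R) (V0 : forall w, (0 <= V w)%R).
Hypothesis indepUV : forall A B, measurable A -> measurable B ->
  P (U @^-1` A `&` V @^-1` B) = P (U @^-1` A) * P (V @^-1` B).

Lemma integral_independentM :
  \int[P]_w (U w * V w)%:E = \int[P]_w (U w)%:E * \int[P]_w (V w)%:E.
Proof.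
pose ab (x : R) := `|x|%:E.
have mab : measurable_fun setT ab.
  by apply: measurableT_comp; [exact: EFin_measurable|exact: normr_measurable].
have law (X : {RV P >-> R}) : (forall w, (0 <= X w)%R) ->
    \int[P]_w (X w)%:E = \int[distribution P X]_x ab x.
  move=> X0; rewrite ge0_integral_distribution//; last by move=> y; rewrite lee_fin.
  by apply: eq_integral => w _; rewrite /ab /= ger0_norm.
transitivity (\int[P]_w (ab (U w) * ab (V w))).
  by apply: eq_integral => w _; rewrite /ab !ger0_norm.
rewrite (@integral_joint_law _ _ _ P _ _ _ _ U V indepUV
  (fun xy => ab xy.1 * ab xy.2)); last 2 first.
- by apply: emeasurable_funM; apply: measurableT_comp.
- by move=> xy; rewrite mule_ge0// lee_fin.
rewrite (law U U0) (law V V0).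
have V1 : 0 <= \int[distribution P V]_y ab y.
  by apply: integral_ge0 => y _; rewrite lee_fin.
transitivity (\int[distribution P U]_x (ab x * \int[distribution P V]_y ab y)).
  apply: eq_integral => x _ /=; rewrite ge0_integralZl//.
  - by move=> y _; rewrite lee_fin.
  - by rewrite lee_fin.
by rewrite ge0_integralZr// => x _; rewrite lee_fin.
Qed.

End product_expectation.

(** The carrier space equipped with the sigma-field generated by the classes
    [E i], [i \in s]: measurability of a random variable on [sub_field E s] says
    that it depends on these sources of randomness only. *)
Notation sub_field E s :=
  (g_sigma_algebraType [set A | exists2 i, i \in s & E i A]).

Lemma measurable_prod_ord d (T : measurableType d) (R : realType)
    (phi : nat -> T -> R) n :
  (forall i, (i < n)%N -> measurable_fun setT (phi i)) ->
  measurable_fun setT (fun w => \prod_(i < n) phi i w).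
Proof.
elim: n => [|n IH] mphi.
  by apply: (@eq_measurable_fun _ _ T R setT (cst 1)) => // w _; rewrite big_ord0.
apply: (@eq_measurable_fun _ _ T R setT (fun w => (\prod_(i < n) phi i w) * phi n w)).
  by move=> w _; rewrite big_ord_recr.
apply: measurable_funM; last exact: mphi.
by apply: IH => i ltin; apply: mphi; exact: ltnW.
Qed.

Section product_of_blocks.
Context d (W : measurableType d) (R : realType) (P : probability W R).
Local Open Scope ereal_scope.
Variables (I : choiceType) (E : I -> set (set W)).
Hypotheses (mE : forall i, E i `<=` measurable) (EI : forall i, setI_closed (E i))
  (ET : forall i, E i setT).
Hypothesis indepE : forall (s : seq I) (A : I -> set W), uniq s ->
  (forall i, E i (A i)) ->
  P (\bigcap_(i in [set` s]) A i) = \prod_(i <- s) P (A i).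

Lemma sub_field_measurable (s : seq I) (f : W -> R) :
  measurable_fun (setT : set (sub_field E s)) f -> measurable_fun (setT : set W) f.
Proof.
move=> mf _ B mB; have := mf measurableT B mB.
apply: sub_sigma_measurable => A [i _ EA]; exact: mE EA.
Qed.

Lemma sub_fieldS (s t : seq I) d' (T' : measurableType d') (f : W -> T') :
  {subset s <= t} -> measurable_fun (setT : set (sub_field E s)) f ->
  measurable_fun (setT : set (sub_field E t)) f.
Proof.
move=> st mf _ B mB; have := mf measurableT B mB.
apply: smallest_sub; first exact: smallest_sigma_algebra.
by move=> A [i /st ti EA]; apply: sub_sigma_algebra; exists i.
Qed.

(** Each new factor depends on sources that none of the previous factors uses. *)
Lemma integral_prod_blocks (s_ : nat -> seq I) (phi : nat -> W -> R) (rho : R) :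
  (forall n, uniq (flatten (mkseq s_ n))) ->
  (forall i, measurable_fun (setT : set (sub_field E (s_ i))) (phi i)) ->
  (forall i w, (0 <= phi i w)%R) ->
  (forall i, \int[P]_w (phi i w)%:E <= rho%:E) -> forall n,
  \int[P]_w (\prod_(i < n) phi i w)%:E <= (rho ^+ n)%:E.
Proof.
move=> us mphi phi0 phirho.
have mprod n : measurable_fun (setT : set (sub_field E (flatten (mkseq s_ n))))
    (fun w => (\prod_(i < n) phi i w)%R).
  apply: measurable_prod_ord => i ltin; apply: sub_fieldS (mphi i) => k ki.
  by apply/flattenP; exists (s_ i) => //; apply: map_f; rewrite mem_iota.
elim=> [|n IH].
  under eq_integral do rewrite big_ord0.
  by rewrite integral_cst// mul1e expr0; exact: probability_le1.
pose Umix := isMeasurableFun.Build _ _ _ _ (fun w => (\prod_(i < n) phi i w)%R)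
  (sub_field_measurable (mprod n)).
pose U : {RV P >-> R} := HB.pack (fun w => (\prod_(i < n) phi i w)%R) Umix.
pose Vmix := isMeasurableFun.Build _ _ _ _ (phi n) (sub_field_measurable (mphi n)).
pose V : {RV P >-> R} := HB.pack (phi n) Vmix.
under eq_integral do rewrite big_ord_recr.
rewrite (@integral_independentM _ _ _ P U V) //; last 3 first.
- by move=> w; rewrite /U /= prodr_ge0.
- by move=> w; exact: phi0.
- move=> A B mA mB.
  have usn : uniq (flatten (mkseq s_ n) ++ s_ n).
    by have := us n.+1; rewrite mkseqS flatten_rcons.
  apply: (sigma_of_independent mE EI ET indepE usn).
    by have := mprod n measurableT A mA; rewrite setTI.
  by have := mphi n measurableT B mB; rewrite setTI.
rewrite exprSr EFinM; apply: lee_pmul => //.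
- by apply: integral_ge0 => w _; rewrite lee_fin /U /= prodr_ge0.
- by apply: integral_ge0 => w _; rewrite lee_fin; exact: phi0.
- exact: phirho.
Qed.

End product_of_blocks.

(** * The noises of the model *)

Section noise.
Context d (W : measurableType d) (R : realType) (P : probability W R).
Context d1 d2 (X : measurableType d1) (Y : measurableType d2).
Variables (zeta : nat -> {RV P >-> X}) (eps : nat -> {RV P >-> Y}).
Hypotheses (zeta_indep : independent_seq P zeta)
  (eps_indep : independent_seq P eps)
  (zeta_eps_indep :
     independent_classes P <<s events zeta >> <<s events eps >>).
Local Open Scope ereal_scope.

(** Both noises form a single independent family, indexed by [nat + nat]: [inl k]
    stands for [eps k] and [inr k] for [zeta k]. *)
Definition noise_events (i : nat + nat) : set (set W) :=
  match i with
  | inl k => [set A | exists2 B, measurable B & A = eps k @^-1` B]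
  | inr k => [set A | exists2 B, measurable B & A = zeta k @^-1` B]
  end.

Lemma noise_events_measurable i : noise_events i `<=` measurable.
Proof.
by case: i => k _ [B mB ->]; rewrite -[X in measurable X]setTI;
  exact: measurable_funPT.
Qed.

Lemma noise_eventsI i : setI_closed (noise_events i).
Proof.
by case: i => k _ _ [A mA ->] [B mB ->]; exists (A `&` B) => //; exact: measurableI.
Qed.

Lemma noise_eventsT i : noise_events i setT.
Proof. by case: i => k; exists setT. Qed.

Definition lefts (s : seq (nat + nat)) : seq nat :=
  pmap (fun i => if i is inl k then Some k else None) s.

Definition rights (s : seq (nat + nat)) : seq nat :=
  pmap (fun i => if i is inr k then Some k else None) s.

Lemma mem_lefts s k : (k \in lefts s) = (inl k \in s).
Proof. by elim: s => [|[j|j] s IH] //=; rewrite !inE IH. Qed.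

Lemma mem_rights s k : (k \in rights s) = (inr k \in s).
Proof. by elim: s => [|[j|j] s IH] //=; rewrite !inE IH. Qed.

Lemma lefts_uniq s : uniq s -> uniq (lefts s).
Proof. by elim: s => [|[j|j] s IH] //= /andP[js /IH us]; rewrite ?mem_lefts ?js. Qed.

Lemma rights_uniq s : uniq s -> uniq (rights s).
Proof. by elim: s => [|[j|j] s IH] //= /andP[js /IH us]; rewrite ?mem_rights ?js. Qed.

Lemma prod_lefts_rights (F : nat + nat -> \bar R) s :
  \prod_(i <- s) F i =
  \prod_(k <- lefts s) F (inl k) * \prod_(k <- rights s) F (inr k).
Proof.
elim: s => [|[j|j] s IH]; first by rewrite !big_nil mule1.
- by rewrite big_cons IH /= big_cons muleA.
- by rewrite big_cons IH /= big_cons muleCA.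
Qed.

Lemma noise_independent (s : seq (nat + nat)) (A : nat + nat -> set W) :
  uniq s -> (forall i, noise_events i (A i)) ->
  P (\bigcap_(i in [set` s]) A i) = \prod_(i <- s) P (A i).
Proof.
move=> us EA; rewrite prod_lefts_rights.
have [B mB AB] : exists2 B : nat -> set Y, (forall k, measurable (B k)) &
    forall k, A (inl k) = eps k @^-1` B k.
  have /choice[B HB] : forall k, exists B, measurable B /\ A (inl k) = eps k @^-1` B.
    by move=> k; have [B mB AB] := EA (inl k); exists B.
  by exists B => k; have [] := HB k.
have [C mC AC] : exists2 C : nat -> set X, (forall k, measurable (C k)) &
    forall k, A (inr k) = zeta k @^-1` C k.
  have /choice[C HC] : forall k, exists C, measurable C /\ A (inr k) = zeta k @^-1` C.
    by move=> k; have [C mC AC] := EA (inr k); exists C.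
  by exists C => k; have [] := HC k.
under eq_bigr do rewrite AB; under [X in _ * X]eq_bigr do rewrite AC.
rewrite -eps_indep//; last exact: lefts_uniq.
rewrite -zeta_indep//; last exact: rights_uniq.
rewrite muleC -zeta_eps_indep; last 2 first.
- apply: (@fin_bigcap_measurable _ (g_sigma_algebraType (events zeta))).
    exact: finite_seq.
  by move=> k _; apply: sub_sigma_algebra; exists k, (C k).
- apply: (@fin_bigcap_measurable _ (g_sigma_algebraType (events eps))).
    exact: finite_seq.
  by move=> k _; apply: sub_sigma_algebra; exists k, (B k).
congr (P _); apply/seteqP; split => [w Aw|w [Cw Bw] [k|k] /= ks].
- by split => k /=; rewrite ?mem_lefts ?mem_rights => /Aw; rewrite ?AB ?AC.
- by rewrite AB; apply: Bw; rewrite /= mem_lefts.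
- by rewrite AC; apply: Cw; rewrite /= mem_rights.
Qed.

Lemma measurable_eps_sub_field (s : seq (nat + nat)) k : inl k \in s ->
  measurable_fun (setT : set (sub_field noise_events s)) (eps k).
Proof.
move=> ks _ B mB; rewrite setTI; apply: sub_sigma_algebra.
by exists (inl k) => //; exists B.
Qed.

Lemma measurable_zeta_sub_field (s : seq (nat + nat)) k : inr k \in s ->
  measurable_fun (setT : set (sub_field noise_events s)) (zeta k).
Proof.
move=> ks _ B mB; rewrite setTI; apply: sub_sigma_algebra.
by exists (inr k) => //; exists B.
Qed.

Lemma noise_sub_field_independent (s t : seq (nat + nat)) (A B : set W) : uniq (s ++ t) ->
  sigma_of noise_events s A -> sigma_of noise_events t B ->
  P (A `&` B) = P A * P B.
Proof.
move=> ust; exact: (sigma_of_independent noise_events_measurable noise_eventsI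
  noise_eventsT noise_independent ust).
Qed.

(** The three noises around a transition are independent. *)
Lemma integral_noise_block k (G : Y * (X * Y) -> \bar R) :
  measurable_fun setT G -> (forall z, 0 <= G z) ->
  \int[P]_w G (eps k w, (zeta k.+1 w, eps k.+1 w)) =
  \int[distribution P (eps k)]_x \int[distribution P (zeta k.+1)]_y
    \int[distribution P (eps k.+1)]_z G (x, (y, z)).
Proof.
move=> mG G0.
have mV : measurable_fun setT (fun w => (zeta k.+1 w, eps k.+1 w)).
  exact: measurable_fun_pair.
pose Vmix := isMeasurableFun.Build _ _ _ _ _ mV.
pose V : {RV P >-> (X * Y)%type} :=
  HB.pack (fun w => (zeta k.+1 w, eps k.+1 w)) Vmix.
rewrite (@integral_joint_law _ _ _ P _ _ _ _ (eps k) V _ G)//; last first.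
  move=> A B mA mB.
  apply: (@noise_sub_field_independent [:: inl k] [:: inr k.+1; inl k.+1]).
  - by rewrite /= !inE /= !andbT; apply/eqP => -[] /eqP; rewrite ltn_eqF.
  - by have := @measurable_eps_sub_field [:: inl k] k (mem_head _ _) measurableT A mA;
      rewrite setTI.
  - have mVs : measurable_fun
        (setT : set (sub_field noise_events [:: inr k.+1; inl k.+1]))
        (fun w => (zeta k.+1 w, eps k.+1 w)).
      apply: measurable_fun_pair.
        by apply: measurable_zeta_sub_field; rewrite mem_head.
      by apply: measurable_eps_sub_field; rewrite !inE eqxx orbT.
    by have := mVs measurableT B mB; rewrite setTI.
apply: eq_integral => x _.
rewrite ge0_integral_distribution//; last exact: (measurableT_comp mG (pair1_measurable x)).
rewrite -(@integral_joint_law _ _ _ P _ _ _ _ (zeta k.+1) (eps k.+1) _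
  (fun yz => G (x, yz)))//; last exact: (measurableT_comp mG (pair1_measurable x)).
move=> A B mA mB.
apply: (@noise_sub_field_independent [:: inr k.+1] [:: inl k.+1]) => //.
- by have := @measurable_zeta_sub_field [:: inr k.+1] k.+1 (mem_head _ _) measurableT A mA;
      rewrite setTI.
- by have := @measurable_eps_sub_field [:: inl k.+1] k.+1 (mem_head _ _) measurableT B mB;
      rewrite setTI.
Qed.

Lemma integral_noise_block0 k (G : Y * (X * Y) -> \bar R) :
  (forall B, measurable B -> P (zeta k.+1 @^-1` B) = P (zeta 1%N @^-1` B)) ->
  (forall j B, measurable B -> P (eps j @^-1` B) = P (eps 0%N @^-1` B)) ->
  measurable_fun setT G -> (forall z, 0 <= G z) ->
  \int[P]_w G (eps k w, (zeta k.+1 w, eps k.+1 w)) =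
  \int[P]_w G (eps 0%N w, (zeta 1%N w, eps 1%N w)).
Proof.
move=> zE eE mG G0; rewrite !integral_noise_block//.
transitivity (\int[distribution P (eps 0%N)]_x
    \int[distribution P (zeta k.+1)]_y
      \int[distribution P (eps k.+1)]_z G (x, (y, z))).
  by apply: eq_measure_integral => B mB _; exact: eE.
apply: eq_integral => x _.
transitivity (\int[distribution P (zeta 1%N)]_y
    \int[distribution P (eps k.+1)]_z G (x, (y, z))).
  by apply: eq_measure_integral => B mB _; exact: zE.
apply: eq_integral => y _; apply: eq_measure_integral => B mB _.
by transitivity (P (eps 0%N @^-1` B)); [exact: eE|apply/esym; exact: eE].
Qed.

End noise.

(** * Exponential moment of one step *)

Section monotone_integral.
Import HBNNSimple.

(** The integral of a nonnegative function is the supremum of the integrals of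
    the simple functions below it, whether or not the function is measurable.
    This matters since the total variation distance of the filters is a supremum
    over uncountably many partitions. *)
Lemma le_integral_nonmeasurable d (W : measurableType d) (R : realType)
    (P : {measure set W -> \bar R}) (f g : W -> \bar R) :
  (forall w, 0 <= f w)%E -> (forall w, f w <= g w)%E ->
  (\int[P]_w f w <= \int[P]_w g w)%E.
Proof.
move=> f0 fg.
have g0 w : (0 <= g w)%E := le_trans (f0 w) (fg w).
rewrite !ge0_integralE// !patch_setT; apply: ereal_sup_le => _ [h hf <-].
by exists h => // w; exact: le_trans (hf w) (fg w).
Qed.

End monotone_integral.

Section step_moment.
Context d (W : measurableType d) (R : realType) (P : probability W R).

(** Convexity of t |-> e^(t z) on [0, 1], deduced from 1 + x <= e^x. *)
Lemma expR_scale_le (t z : R) : 0 <= t -> t <= 1 ->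
  expR (t * z) <= 1 + t * (expR z - 1).
Proof.
move=> t0 t1.
have h1 := expR_ge1Dx (z - t * z); have h0 := expR_ge1Dx (- (t * z)).
have e1 : expR z = expR (t * z) * expR (z - t * z).
  by rewrite -expRD; congr expR; ring.
have e0 : 1 = expR (t * z) * expR (- (t * z)) by rewrite -expRD subrr expR0.
have p := expR_gt0 (t * z).
have q1 : expR (t * z) * (1 + (z - t * z)) <= expR z by rewrite e1 ler_wpM2l// ltW.
have q0 : expR (t * z) * (1 - t * z) <= 1 by rewrite [leRHS]e0 ler_wpM2l// ltW.
have q1' : t * (expR (t * z) * (1 + (z - t * z))) <= t * expR z by rewrite ler_wpM2l.
have q0' : (1 - t) * (expR (t * z) * (1 - t * z)) <= (1 - t) * 1.
  by rewrite ler_wpM2l// subr_ge0.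
lra.
Qed.

Lemma exists_small_event (bad : nat -> set W) (e : R) : 0 < e ->
  (forall n, measurable (bad n)) -> nonincreasing_seq bad ->
  \bigcap_n bad n = set0 -> exists n, (P (bad n) <= e%:E)%E.
Proof.
move=> e0 mbad nibad bad0.
have : P (bad n) @[n --> \oo] --> P (\bigcap_n bad n).
  apply: nonincreasing_cvg_mu => //; last exact: bigcapT_measurable.
  by rewrite (le_lt_trans (probability_le1 _ _))// ltry.
rewrite bad0 measure0 => /fine_cvgP[_ /cvgrPdist_lt/(_ e e0)[n _ /(_ n (leqnn n))]].
rewrite /= sub0r normrN => Pn; exists n.
have fP : P (bad n) \is a fin_num by rewrite fin_num_measure.
by rewrite -(fineK fP) lee_fin (le_trans (ler_norm _))// ltW.
Qed.

Variables (Z : W -> R) (tau C : R) (bad : nat -> set W).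
Hypotheses (mZ : measurable_fun setT Z) (tau0 : 0 < tau)
  (Zmgf : (\int[P]_w (expR (tau * Z w))%:E < +oo)%E)
  (mbad : forall n, measurable (bad n)) (nibad : nonincreasing_seq bad)
  (bad0 : \bigcap_n bad n = set0).

(** For l large and a bad event of small probability the exponent is close to 0
    in exponential moment: at theta = 1/4 the expectation is at most 5/4, and
    [expR_scale_le] interpolates between theta = 0 and theta = 1/4. It is
    essential that l and n do not depend on theta. *)
Lemma step_moment : exists l n, 0 < l /\ forall theta, 0 <= theta -> theta <= 4^-1 ->
  (\int[P]_w (expR (4 * theta * (\1_(bad n) w + C / l + 4 * Z w / l)))%:E
     <= (1 + theta)%:E)%E.
Proof.
set m := fine (\int[P]_w (expR (tau * Z w))%:E).
have I0 : (0 <= \int[P]_w (expR (tau * Z w))%:E)%E.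
  by apply: integral_ge0 => w _; rewrite lee_fin expR_ge0.
have m0 : 0 <= m by rewrite fine_ge0.
have mE : (\int[P]_w (expR (tau * Z w))%:E = m%:E)%E.
  by rewrite fineK// ge0_fin_numE.
have [n Pn] : exists n, (P (bad n) <= ((10 * expR 2)^-1)%:E)%E.
  by apply: exists_small_event => //; rewrite invr_gt0 mulr_gt0// expR_gt0.
have ln0 : 0 < ln (11 / 10) :> R by rewrite ln_gt0//; lra.
(* The first term makes 8 / (l tau) <= 1, the second one bounds the contribution
   of [Z] by 1/20, and the third one bounds e^(C / l) by 11/10. *)
set l := 8 / tau + 80 * m / tau + `|C| / ln (11 / 10) + 1.
have hA : 0 <= 8 / tau by rewrite divr_ge0// ltW.
have hB : 0 <= 80 * m / tau by rewrite divr_ge0 ?mulr_ge0// ltW.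
have hC : 0 <= `|C| / ln (11 / 10) by rewrite divr_ge0// ltW.
have l0 : 0 < l by rewrite /l; lra.
have [lA lB lC] : [/\ 8 / tau <= l, 80 * m / tau <= l & `|C| / ln (11 / 10) <= l].
  by rewrite /l; split; lra.
exists l, n; split => // theta theta0 theta1.
set t := 4 * theta.
have t0 : 0 <= t by rewrite mulr_ge0.
have t1 : t <= 1 by rewrite /t; lra.
set k1 := 1 + (1 / 10) * t.
set k2 := t * (11 / 10) * (expR 2 / 2).
set k3 := t * (11 / 10) * (4 / (l * tau)).
have Cl : expR (C / l) <= 11 / 10.
  rewrite -[leRHS]lnK ?posrE; last by lra.
  rewrite ler_expR (le_trans (ler_norm _))// normrM normfV (gtr0_norm l0).
  by rewrite ler_pdivrMr// mulrC -ler_pdivrMr.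
have ltau0 : 0 < l * tau by rewrite mulr_gt0.
have l8 : 0 <= 8 / (l * tau) <= 1.
  rewrite divr_ge0 ?(ltW ltau0)//= ler_pdivrMr// mul1r.
  by rewrite -ler_pdivrMr.
have l80 : 4 / (l * tau) * m <= 1 / 20.
  by rewrite mulrAC ler_pdivrMr//; move: lB; rewrite ler_pdivrMr//; lra.
have pointwise w : expR (t * (\1_(bad n) w + C / l + 4 * Z w / l)) <=
    k1 + (k2 * \1_(bad n) w + k3 * expR (tau * Z w)).
  apply: (le_trans (expR_scale_le _ t0 t1)).
  set be := \1_(bad n) w; set z := Z w.
  have hb : expR (2 * be) <= 1 + expR 2 * be.
    rewrite /be indicE; case: (w \in bad n); rewrite ?mulr0 ?expR0 ?addr0// !mulr1.
    by rewrite lerDr.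
  have hz : expR (8 * z / l) <= 1 + 8 / (l * tau) * expR (tau * z).
    have /andP[l81 l82] := l8.
    rewrite (_ : 8 * z / l = 8 / (l * tau) * (tau * z)); last first.
      by field; rewrite !gt_eqF.
    apply: (le_trans (expR_scale_le _ l81 l82)); rewrite lerD2l ler_wpM2l//.
    by rewrite gerBl.
  have hbz : expR (be + 4 * z / l) <= 2^-1 * (expR (2 * be) + expR (8 * z / l)).
    set x := expR be; set y := expR (4 * z / l).
    have -> : expR (2 * be) = x ^+ 2 by rewrite /x -expRM_natl.
    have -> : expR (8 * z / l) = y ^+ 2.
      by rewrite /y -expRM_natl; congr expR; ring.
    rewrite expRD -/x -/y; have := sqr_ge0 (x - y); lra.
  have hT : expR (be + C / l + 4 * z / l) <=
      11 / 10 * (1 + expR 2 / 2 * be + 4 / (l * tau) * expR (tau * z)).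
    rewrite (_ : be + C / l + 4 * z / l = C / l + (be + 4 * z / l)); last by ring.
    rewrite expRD ler_pM ?expR_ge0// (le_trans hbz)//.
    have : 8 / (l * tau) * expR (tau * z) = 2 * (4 / (l * tau) * expR (tau * z)).
      by field; rewrite !gt_eqF.
    lra.
  have : t * expR (be + C / l + 4 * z / l) <= t * (11 / 10 *
    (1 + expR 2 / 2 * be + 4 / (l * tau) * expR (tau * z))) by rewrite ler_wpM2l.
  rewrite /k1 /k2 /k3; move: (expR _) (4 / (l * tau)) (expR (tau * z)) => *; lra.
have k20 : 0 <= k2 by rewrite !mulr_ge0 ?expR_ge0// invr_ge0.
have k30 : 0 <= k3.
  by rewrite !mulr_ge0// ?invr_ge0 ?mulr_ge0 ?ltW.
have mI : measurable_fun setT (fun w => (\1_(bad n) w)%:E : \bar R).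
  exact/measurable_EFinP/measurable_indic.
have mX : measurable_fun setT (fun w => (expR (tau * Z w))%:E).
  by apply/measurable_EFinP; apply: measurableT_comp => //; exact: measurable_funM.
apply: (@le_trans _ _ (\int[P]_w (k1%:E + (k2%:E * (\1_(bad n) w)%:E +
    k3%:E * (expR (tau * Z w))%:E)))%E).
  apply: le_integral_nonmeasurable => w; first by rewrite lee_fin expR_ge0.
  by rewrite -!EFinM -!EFinD lee_fin; exact: pointwise.
rewrite ge0_integralD//; last 3 first.
- by move=> w _; rewrite lee_fin addr_ge0// mulr_ge0.
- by move=> w _; rewrite adde_ge0// mule_ge0// lee_fin// expR_ge0.
- by apply: emeasurable_funD; apply: emeasurable_funM.
rewrite ge0_integralD//; last 4 first.
- by move=> w _; rewrite mule_ge0// lee_fin.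
- by apply: emeasurable_funM.
- by move=> w _; rewrite mule_ge0// lee_fin expR_ge0.
- by apply: emeasurable_funM.
rewrite !ge0_integralZl_EFin// mE integral_indic// setIT.
have -> : (\int[P]__ k1%:E = k1%:E)%E.
  rewrite integral_cst// -[RHS]mule1; congr (_ * _)%E.
  exact: (probability_setT P).
have k2P : (k2%:E * P (bad n) <= (k2 / (10 * expR 2))%:E)%E.
  rewrite (_ : (k2 / _)%:E = k2%:E * ((10 * expR 2)^-1)%:E)%E//.
  by rewrite lee_wpmul2l// lee_fin.
apply: (@le_trans _ _ (k1%:E + ((k2 / (10 * expR 2))%:E + k3%:E * m%:E))%E).
  by rewrite leeD2l// leeD2r.
rewrite -EFinM -!EFinD lee_fin.
have -> : k2 / (10 * expR 2) = t * (11 / 200).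
  by rewrite /k2; field; rewrite gt_eqF// expR_gt0.
have -> : k3 * m = t * (11 / 10) * (4 / (l * tau) * m) by rewrite /k3; ring.
have : t * (4 / (l * tau) * m) <= t * (1 / 20) by rewrite ler_wpM2l.
rewrite /k1 /t; move: (4 / (l * tau) * m) => z; lra.
Qed.

End step_moment.

(** * The Euclidean norm *)

Section euclidean_norm.
Context {R : realType}.

Lemma measurable_subrow d (T : measurableType d) n (u v : T -> 'rV[R]_n) :
  measurable_fun setT u -> measurable_fun setT v ->
  measurable_fun setT (fun t => u t - v t).
Proof.
move=> mu mv; apply: measurable_to_row => i.
apply: (@eq_measurable_fun _ _ T R setT (fun t => u t ord0 i - v t ord0 i)).
  by move=> t _; rewrite !mxE.
by apply: measurable_funB; apply: (measurableT_comp (measurable_coord i)).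
Qed.

Lemma measurable_sumrow d (T : measurableType d) n (u v : T -> 'rV[R]_n) :
  measurable_fun setT u -> measurable_fun setT v ->
  measurable_fun setT (fun t => u t + v t).
Proof.
move=> mu mv; apply: measurable_to_row => i.
apply: (@eq_measurable_fun _ _ T R setT (fun t => u t ord0 i + v t ord0 i)).
  by move=> t _; rewrite !mxE.
by apply: measurable_funD; apply: (measurableT_comp (measurable_coord i)).
Qed.

Lemma measurable_enorm n : measurable_fun setT (@enorm R n).
Proof.
apply: (@measurableT_comp _ _ _ _ _ _ (@Num.sqrt R)).
  by apply: nondecreasing_measurable => // x y xy; exact: ler_wsqrtr.
apply: (@eq_measurable_fun _ _ 'rV[R]_n R setT
    (fun x => \sum_(i <- enum 'I_n) x ord0 i ^+ 2)).
  by move=> x _; rewrite big_enum.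
apply: measurable_sum => i; apply: measurable_funX; exact: measurable_coord.
Qed.

Lemma enorm_ge0 n (x : 'rV[R]_n) : 0 <= enorm x. Proof. exact: sqrtr_ge0. Qed.

Lemma enorm_sqr n (x : 'rV[R]_n) : enorm x ^+ 2 = \sum_i x ord0 i ^+ 2.
Proof. by rewrite sqr_sqrtr// sumr_ge0// => i _; exact: sqr_ge0. Qed.

Lemma enormN n (x : 'rV[R]_n) : enorm (- x) = enorm x.
Proof. by congr Num.sqrt; apply: eq_bigr => i _; rewrite mxE sqrrN. Qed.

Lemma enormBC n (x y : 'rV[R]_n) : enorm (x - y) = enorm (y - x).
Proof. by rewrite -enormN opprB. Qed.

Lemma coord_le_enorm n (x : 'rV[R]_n) i : `|x ord0 i| <= enorm x.
Proof.
rewrite -sqrtr_sqr ler_wsqrtr// (bigD1 i)//= lerDl sumr_ge0// => j _.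
exact: sqr_ge0.
Qed.

(** Expand the sum of the squares of |y| x_i - |x| y_i. *)
Lemma enorm_cauchy n (x y : 'rV[R]_n) :
  \sum_i x ord0 i * y ord0 i <= enorm x * enorm y.
Proof.
set a := enorm x; set b := enorm y.
have a0 : 0 <= a := enorm_ge0 x; have b0 : 0 <= b := enorm_ge0 y.
have [ab0|] := boolP (0 < a * b).
  have : 0 <= \sum_i (b * x ord0 i - a * y ord0 i) ^+ 2.
    by apply: sumr_ge0 => i _; exact: sqr_ge0.
  have -> : \sum_i (b * x ord0 i - a * y ord0 i) ^+ 2 =
      b ^+ 2 * \sum_i x ord0 i ^+ 2 - 2 * (a * b) * \sum_i x ord0 i * y ord0 i +
      a ^+ 2 * \sum_i y ord0 i ^+ 2.
    rewrite !mulr_sumr -sumrB -big_split /=.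
    by apply: eq_bigr => i _; ring.
  rewrite -!enorm_sqr -/a -/b; set S := \sum_i _ => h.
  have : 0 <= (a * b) * (a * b - S) by move: h; nra.
  by rewrite pmulr_rge0// subr_ge0.
rewrite -leNgt => ab0.
have [/eqP|/eqP] : a == 0 \/ b == 0.
  have /eqP : a * b = 0 by apply/eqP; rewrite eq_le ab0 mulr_ge0.
  by rewrite mulf_eq0 => /orP.
- move=> a00; rewrite a00 mul0r big1// => i _.
  by have := coord_le_enorm x i; rewrite -/a a00 normr_le0 => /eqP ->; rewrite mul0r.
- move=> b00; rewrite b00 mulr0 big1// => i _.
  by have := coord_le_enorm y i; rewrite -/b b00 normr_le0 => /eqP ->; rewrite mulr0.
Qed.

Lemma enormD_le n (x y : 'rV[R]_n) : enorm (x + y) <= enorm x + enorm y.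
Proof.
rewrite -(@ler_pXn2r _ 2)// ?nnegrE ?addr_ge0 ?enorm_ge0//.
rewrite sqrrD !enorm_sqr.
have -> : \sum_i (x + y) ord0 i ^+ 2 = \sum_i x ord0 i ^+ 2 +
    (\sum_i x ord0 i * y ord0 i) *+ 2 + \sum_i y ord0 i ^+ 2.
  by rewrite -sumrMnl -!big_split /=; apply: eq_bigr => i _; rewrite mxE sqrrD.
by rewrite lerD2r lerD2l lerMn2r enorm_cauchy orbT.
Qed.

Lemma enorm_triangle n (z x y : 'rV[R]_n) :
  enorm (x - y) <= enorm (x - z) + enorm (z - y).
Proof. by rewrite -[x - y](subrKA z) enormD_le. Qed.

Lemma enorm_le_sum n (x : 'rV[R]_n) : enorm x <= \sum_i `|x ord0 i|.
Proof.
rewrite -(@ler_pXn2r _ 2)// ?nnegrE ?enorm_ge0 ?sumr_ge0// enorm_sqr.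
rewrite expr2 mulr_suml; apply: ler_sum => i _.
rewrite -real_normK ?num_real// expr2 ler_wpM2l//.
by rewrite (bigD1 i)//= lerDl sumr_ge0.
Qed.

Lemma enorm0 n : enorm (0 : 'rV[R]_n) = 0.
Proof. by rewrite /enorm big1 ?sqrtr0// => i _; rewrite mxE expr0n. Qed.

Lemma enorm_dim0 n (x : 'rV[R]_n) : n = 0%N -> enorm x = 0.
Proof. by move=> n0; subst n; rewrite (thinmx0 x) enorm0. Qed.

Lemma compact_cube n (r : R) :
  compact [set y : 'rV[R]_n | forall i, y ord0 i \in `[- r, r]].
Proof.
exact: (@rV_compact R n (fun=> `[- r, r]%classic) (fun=> @segment_compact R _ _)).
Qed.

Lemma enorm_large n (r : R) : (0 < n)%N -> exists y : 'rV[R]_n, r <= enorm y.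
Proof.
case: n => // n _; exists (const_mx r).
by rewrite (le_trans (ler_norm r))// (le_trans _ (coord_le_enorm _ ord0))// mxE.
Qed.

End euclidean_norm.

(** * Constants attached to the model *)

Section model_constants.
Context {R : realType} (N p : nat).
Local Notation X := 'rV[R]_N.
Local Notation Y := 'rV[R]_p.
Variables (f : X -> X) (h : X -> Y) (gam : X -> R) (ups : Y -> R).
Variables (a b0 b : R).
Hypotheses (mh : measurable_fun setT h) (E1 : assumption_E1 f h a b0 b).

(** In positive dimension there are points arbitrarily far apart, which excludes
    negative a and b; b0 is tested on equal points. *)
Lemma E1_signs : (0 < N)%N -> [/\ 0 <= a, 0 <= b0 & 0 <= b].
Proof.
move=> N0; have [fa _ _ hb] := E1.
have b00 : 0 <= b0.
  by have := hb 0 0; rewrite !subrr !enorm0 mulr0 addr0.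
split => //.
- have [x x1] := @enorm_large R N 1 N0.
  have := le_trans (enorm_ge0 _) (fa x 0); rewrite subr0.
  by rewrite pmulr_lge0// (lt_le_trans _ x1).
- rewrite leNgt; apply/negP => b_lt0.
  have [x xb] := @enorm_large R N (b0 + 1) N0.
  have := hb x 0; rewrite subr0 leNgt => /negP; apply.
  rewrite (@le_lt_trans _ _ b0)//; last by rewrite (lt_le_trans _ xb)// ltrDl.
  by rewrite gerDl nmulr_rle0// enorm_ge0.
Qed.

Lemma measurable_Cset y Delta : measurable (Cset h y Delta).
Proof.
have mC : measurable_fun setT (fun x => enorm (h x - y)).
  by apply: (measurableT_comp (@measurable_enorm _ _)); exact: measurable_subrow.
have := mC measurableT `]-oo, Delta]%classic (measurable_itv _).
by rewrite setTI (_ : _ @^-1` _ = Cset h y Delta).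
Qed.

(** The center is a preimage of y, and the side comes from the uniform continuity
    of h, hence does not depend on y. *)
Lemma cube_sub_Cset Delta : 0 < Delta -> exists2 delta, 0 < delta &
  forall y, exists c : X, cube c delta `<=` Cset h y Delta.
Proof.
move=> D0; have [_ uc sur _] := E1.
pose e := Delta / p.+1%:R.
have e0 : 0 < e by rewrite divr_gt0.
have := uc _ (entourage_ball Y (PosNum e0)).
rewrite /= -entourage_ballE => -[delta /= delta0 sub].
exists delta => // y; have [c _ hc] := sur y I; exists c => x xc /=.
rewrite /Cset /= enormBC (le_trans (enorm_le_sum _))//.
have hx j : `|(y - h x) ord0 j| <= e.
  have bcx : ball c delta x by split => // i j'; rewrite (ord1 i); exact: xc.
  have [_ /(_ ord0 j)] := sub (c, x) bcx.
  by rewrite /= hc /ball /= !mxE => /ltW.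
apply: (@le_trans _ _ (\sum_(j < p) e)); first exact: ler_sum.
have p1 : p.+1%:R^-1 * p%:R <= 1 :> R.
  by rewrite mulrC ler_pdivrMr// mul1r ler_nat.
by rewrite sumr_const card_ord -[leLHS]mulr_natr /e -mulrA ler_piMr// ltW.
Qed.

Lemma lebesgue_Cset Delta : 0 < Delta -> exists2 v, 0 < v &
  forall y, (v%:E <= @lebesgue_rV R N (Cset h y Delta))%E.
Proof.
move=> /cube_sub_Cset[delta delta0 sub]; exists ((delta *+ 2) ^+ N).
  by rewrite exprn_gt0// pmulrn_lgt0.
move=> y; have [c cC] := sub y; rewrite -(lebesgue_rV_cube c delta0).
by apply: le_measure => //; rewrite inE; [exact: measurable_cube|exact: measurable_Cset].
Qed.

Hypothesis E2 : assumption_E2 ups.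
Hypothesis ups0 : forall u, 0 < ups u.

Lemma ups_bounded : exists2 M, 0 < M & forall u, ups u <= M.
Proof.
have [[M uM] _ _] := E2; exists M => //.
exact: lt_le_trans (ups0 0) (uM 0).
Qed.

Lemma ups_vanishes e : 0 < e -> exists2 D, 0 <= D &
  forall u, D < enorm u -> ups u <= e.
Proof.
move=> e0; have [_ /(_ e e0)[D uD] _] := E2; exists (Num.max D 0).
  by rewrite le_max lexx orbT.
move=> u; rewrite gt_max => /andP[/ltW /uD uu _].
by rewrite (le_trans (ler_norm _))// ltW.
Qed.

(** The closed ball lies in a compact cube. *)
Lemma ups_minorized D : 0 <= D -> exists2 um, 0 < um &
  forall u, enorm u <= D -> um <= ups u.
Proof.
move=> D0; have [_ _ /(_ _ (@compact_cube R p D))] := E2.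
set S := [set _ | y in _] => infS.
have inS u : enorm u <= D -> S (ups u)%:E.
  move=> uD; exists u => //= i; rewrite in_itv /= -ler_norml.
  exact: le_trans (coord_le_enorm _ _) uD.
have fS : ereal_inf S \is a fin_num.
  rewrite ge0_fin_numE ?ltW// (@le_lt_trans _ _ (ups 0)%:E) ?ltry//.
  by apply: ereal_inf_lbound; apply: inS; rewrite enorm0.
exists (fine (ereal_inf S)); first by rewrite fine_gt0// infS -ge0_fin_numE ?fS ?ltW.
by move=> u uD; rewrite -lee_fin fineK//; apply: ereal_inf_lbound; exact: inS.
Qed.

Hypothesis gam_bounds : forall r : R, 0 <= r ->
  [/\ (0 < gamma_minus gam r)%E, (gamma_minus gam r <= gamma_plus gam r)%E
    & (gamma_plus gam r < +oo)%E].

Lemma gamma_minusP r : 0 <= r -> 0 < fine (gamma_minus gam r) /\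
  forall s, enorm s <= r -> fine (gamma_minus gam r) <= gam s.
Proof.
move=> r0; have [m0 mp poo] := gam_bounds r0.
have moo := le_lt_trans mp poo.
split; first by rewrite fine_gt0// m0.
move=> s sr; rewrite -lee_fin fineK ?ge0_fin_numE ?(ltW m0)//.
by apply: ereal_inf_lbound; exists s.
Qed.

Lemma gamma_plusP r : 0 <= r -> 
  forall s, enorm s <= r -> gam s <= fine (gamma_plus gam r).
Proof.
move=> r0 s sr; have [m0 mp poo] := gam_bounds r0.
rewrite -lee_fin fineK ?ge0_fin_numE// ?(le_trans (ltW m0) mp)//.
by apply: ereal_sup_ubound; exists s.
Qed.

(** Monotonicity holds for nonnegative radii only: for a negative radius the
    infimum is taken over the empty set, hence is infinite, and [fine] makes it
    0. *)
Lemma measurable_gamma_minus :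
  measurable_fun setT (fun r : R => fine (gamma_minus gam (Num.max r 0))).
Proof.
apply: nonincreasing_measurable => // r r' rr'.
have M0 (x : R) : 0 <= Num.max x 0 by rewrite le_max lexx orbT.
have [m0 mp poo] := gam_bounds (M0 r); have [m0' mp' poo'] := gam_bounds (M0 r').
apply: fine_le.
- by rewrite ge0_fin_numE ?ltW// (le_lt_trans mp').
- by rewrite ge0_fin_numE ?ltW// (le_lt_trans mp).
apply: ereal_inf_le_tmp => _ [s /= sr <-]; exists s => //=.
by rewrite (le_trans sr)// ge_max !le_max rr' lexx orbT.
Qed.

Hypotheses (a0 : 0 <= a) (b00 : 0 <= b0) (bge0 : 0 <= b).

(** The argument of [gamma_minus] in [Zvar], as a function of the three noises
    that surround one transition. *)
Definition radius (D : R) (t : Y * (X * Y)) : R :=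
  2 * (a + 1) * b0 + (a + 1) * b * D + a * b * enorm t.1 + enorm t.2.1 +
  b * enorm t.2.2.

Lemma radius_ge0 D t : 0 <= D -> 0 <= radius D t.
Proof. by move=> D0; rewrite /radius !addr_ge0 ?mulr_ge0 ?enorm_ge0 ?addr_ge0. Qed.

Lemma measurable_radius D : measurable_fun setT (radius D).
Proof.
rewrite /radius; apply: measurable_funD; last first.
  apply: measurable_funM => //; apply: (measurableT_comp (@measurable_enorm _ _)).
  exact: measurableT_comp.
apply: measurable_funD; last first.
  apply: (measurableT_comp (@measurable_enorm _ _)); exact: measurableT_comp.
apply: measurable_funD => //; apply: measurable_funM => //.
exact: (measurableT_comp (@measurable_enorm _ _)).
Qed.

(** E1 turns the proximity of h x and h X0 into that of x and X0, and likewise one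
    step later; the state itself moves by z. *)
Lemma transition_radius (x x' X0 : X) (e z e' : _) D : 0 <= D ->
  Cset h (h X0 + e) D x ->
  Cset h (h (f X0 + z) + e') D x' ->
  enorm (x' - f x) <= radius D (e, (z, e')).
Proof.
move=> D0 /= Cx Cx'; have [fa _ _ hb] := E1.
set X1 := f X0 + z in Cx' *.
have h1 : enorm (h x' - h X1) <= D + enorm e'.
  rewrite (le_trans (enorm_triangle (h X1 + e') _ _))// lerD//.
  by rewrite addrAC subrr add0r.
have h0 : enorm (h x - h X0) <= D + enorm e.
  rewrite (le_trans (enorm_triangle (h X0 + e) _ _))// lerD//.
  by rewrite addrAC subrr add0r.
have d1 : enorm (x' - X1) <= b0 + b * (D + enorm e').
  by rewrite (le_trans (hb _ _))// lerD2l ler_wpM2l.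
have d0 : enorm (X0 - x) <= b0 + b * (D + enorm e).
  by rewrite (le_trans (hb _ _))// lerD2l ler_wpM2l// enormBC.
have d01 : enorm (X1 - f x) <= a * (b0 + b * (D + enorm e)) + enorm z.
  rewrite /X1 addrAC (le_trans (enormD_le _ _))// lerD2r (le_trans (fa _ _))//.
  exact: ler_wpM2l.
rewrite (le_trans (enorm_triangle X1 _ _))// (le_trans (lerD d1 d01))//.
have ab0 : 0 <= (a + 1) * b0 by rewrite mulr_ge0// addr_ge0.
rewrite /radius /=; nra.
Qed.

End model_constants.

(** * The filter as a real-valued recursion *)

Section filter_link.
Context {R : realType} (N p : nat).
Local Notation X := 'rV[R]_N.
Local Notation Y := 'rV[R]_p.
Local Notation leb := (@lebesgue_rV R N).
Variables (f : X -> X) (h : X -> Y) (gam : X -> R) (ups : Y -> R) (M : R).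
Hypotheses (mf : measurable_fun setT f) (mh : measurable_fun setT h)
  (gam_density : positive_density gam) (ups_density : positive_density ups)
  (upsM : forall u, ups u <= M).

Definition trans (x u : X) : R := gam (u - f x).

Lemma trans_gt0 x u : 0 < trans x u.
Proof. by have [_ g0 _] := gam_density; exact: g0. Qed.

Lemma trans_ge0 x u : 0 <= trans x u. Proof. exact/ltW/trans_gt0. Qed.

Lemma measurable_trans :
  measurable_fun setT (fun xu : X * X => trans xu.1 xu.2).
Proof.
have [mg _ _] := gam_density; apply: (measurableT_comp mg).
by apply: measurable_subrow => //; exact: measurableT_comp.
Qed.

Lemma measurable_trans1 x : measurable_fun setT (trans x).
Proof. exact: (measurableT_comp measurable_trans (pair1_measurable x)). Qed.

(** Translation invariance of Lebesgue measure. *)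
Lemma trans_mass x : (\int[leb]_u (trans x u)%:E = 1)%E.
Proof.
have [mg g0 <-] := gam_density.
rewrite -(lebesgue_rV_integral_shift (- f x) (G := fun u => (gam u)%:E))//.
  exact/measurable_EFinP.
by move=> u; rewrite lee_fin ltW.
Qed.

Lemma lik_gt0 x y : 0 < lik h ups x y.
Proof. by have [_ u0 _] := ups_density; exact: u0. Qed.

Lemma measurable_lik2 : measurable_fun setT (fun xy : X * Y => lik h ups xy.1 xy.2).
Proof.
have [mu _ _] := ups_density; apply: (measurableT_comp mu).
by apply: measurable_subrow => //; exact: measurableT_comp.
Qed.

Lemma measurable_lik y : measurable_fun setT (fun x => lik h ups x y).
Proof. exact: (measurableT_comp measurable_lik2 (pair2_measurable y)). Qed.

Lemma integral_Qker x (F : X -> R) : measurable_fun setT F -> (forall u, 0 <= F u) ->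
  (\int[Qker f gam x]_u (F u)%:E = \int[leb]_u (trans x u * F u)%:E)%E.
Proof.
move=> mF F0.
by rewrite (@integral_with_density _ _ _ leb (trans x) (measurable_trans1 x)
  (trans_ge0 x) (EFin \o F))//; exact/measurable_EFinP.
Qed.

Lemma QkerE x A : measurable A ->
  Qker f gam x A = (\int[leb]_u (trans x u * \1_A u))%:E.
Proof.
move=> mA; rewrite /Rintegral fineK; last first.
  apply: integrable_fin_num => //.
  exact: (integrable_indic_kernel trans_ge0 measurable_trans trans_mass).
rewrite /Qker [LHS]integral_mkcond.
apply: eq_integral => u _.
by rewrite patchE indicE; case: (u \in A); rewrite ?mulr1 ?mulr0.
Qed.

Section fixed_observations.
Variable y : nat -> Y.

Definition obs_lik k x : R := lik h ups x (y k).

Local Notation fut := (future leb trans obs_lik).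
Local Notation unn := (unnorm leb trans obs_lik).

Lemma measurable_obs_lik k : measurable_fun setT (obs_lik k).
Proof. exact: measurable_lik. Qed.

Lemma obs_lik_ge0 k x : 0 <= obs_lik k x. Proof. exact/ltW/lik_gt0. Qed.

Lemma obs_lik_le k x : obs_lik k x <= M. Proof. exact: upsM. Qed.

Lemma indic01 (A : set X) x : 0 <= (\1_A : X -> R) x <= 1.
Proof. by rewrite indicE; case: (x \in A); rewrite ?lexx ?ler01. Qed.

Lemma filter_futureE A m k x : measurable A ->
  filter_future f h gam ups y A k m x = (fut \1_A k m x)%:E.
Proof.
move=> mA; elim: m k x => [//|m IH] k x /=.
have mI : measurable_fun setT (\1_A : X -> R) by exact: measurable_indic.
have [mF F0] := future_bounded trans_ge0 measurable_trans trans_mass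
  measurable_obs_lik obs_lik_ge0 obs_lik_le mI (indic01 A) m k.+1.
transitivity (\int[Qker f gam x]_u (obs_lik k.+1 u * fut \1_A k.+1 m u)%:E)%E.
  by congr integral; apply/funext => u; rewrite IH EFinM.
rewrite integral_Qker//; last 2 first.
- by apply: measurable_funM => //; exact: measurable_obs_lik.
- by move=> u; rewrite mulr_ge0 ?obs_lik_ge0//; have /andP[] := F0 u.
rewrite /Rintegral fineK//; apply: integrable_fin_num => //.
exact: (integrable_future trans_ge0 measurable_trans trans_mass
  measurable_obs_lik obs_lik_ge0 obs_lik_le mI (indic01 A)).
Qed.

Lemma filter_unnormE (nu : probability X R) n A : measurable A ->
  filter_unnorm f h gam ups nu n y A = (unn nu \1_A n)%:E.
Proof.
move=> mA; rewrite /filter_unnorm /unnorm /Rintegral fineK.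
  by apply: eq_integral => x _; rewrite filter_futureE.
apply: integrable_fin_num => //.
apply: (integrable_unnorm trans_ge0 measurable_trans trans_mass
  measurable_obs_lik obs_lik_ge0 obs_lik_le) => //; exact: indic01.
Qed.

Lemma filter_distE (nu : probability X R) n A : measurable A ->
  0 < unn nu (fun=> 1) n ->
  filter_dist f h gam ups nu n y A = (unn nu \1_A n / unn nu (fun=> 1) n)%:E.
Proof.
move=> mA Z0; rewrite /filter_dist !filter_unnormE//.
rewrite (_ : \1_setT = (fun=> 1) :> (X -> R)); last first.
  by apply/funext => x; rewrite indicT.
by rewrite EFinM inver gt_eqF.
Qed.

Lemma nu_g_QE (nu : probability X R) A : measurable A ->
  nu_g_Q f h gam ups nu (y 0%N) A =
  (\int[nu]_x (obs_lik 0%N x * \int[leb]_u (trans x u * \1_A u)))%:E.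
Proof.
move=> mA; rewrite /nu_g_Q /Rintegral fineK.
  by apply: eq_integral => x _; rewrite QkerE.
apply: integrable_fin_num => //.
exact: (integrable_one_step trans_ge0 measurable_trans trans_mass
  measurable_obs_lik obs_lik_ge0 obs_lik_le).
Qed.

End fixed_observations.
End filter_link.

(** * The bound along one trajectory *)

Section path_bound.
Context {R : realType} (N p : nat).
Local Notation X := 'rV[R]_N.
Local Notation Y := 'rV[R]_p.
Local Notation leb := (@lebesgue_rV R N).
Variables (f : X -> X) (h : X -> Y) (gam : X -> R) (ups : Y -> R) (M : R).
Hypotheses (mf : measurable_fun setT f) (mh : measurable_fun setT h)
  (gam_density : positive_density gam) (ups_density : positive_density ups)
  (M_gt0 : 0 < M) (upsM : forall u, ups u <= M).
Hypothesis gam_bounds : forall r : R, 0 <= r ->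
  [/\ (0 < gamma_minus gam r)%E, (gamma_minus gam r <= gamma_plus gam r)%E
    & (gamma_plus gam r < +oo)%E].
Variables (a b0 b : R).
Hypotheses (E1 : assumption_E1 f h a b0 b)
  (a0 : 0 <= a) (b00 : 0 <= b0) (bge0 : 0 <= b).

(** The observations come from a path of the model. *)
Variables (x : nat -> X) (z : nat -> X) (e : nat -> Y) (y : nat -> Y).
Hypotheses (x_dyn : forall k, x k.+1 = f (x k) + z k.+1)
  (y_obs : forall k, y k = h (x k) + e k).

Definition noise_block (z : nat -> X) (e : nat -> Y) (k : nat) : Y * (X * Y) :=
  (e k, (z k.+1, e k.+1)).

Definition good_block (B : R) (t : Y * (X * Y)) : bool :=
  [&& enorm t.1 <= B, enorm t.2.1 <= B & enorm t.2.2 <= B].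

(** [Zvar] as a function of the three noises around one transition. *)
Definition Zblock (D : R) (t : Y * (X * Y)) : R :=
  - ln (fine (gamma_minus gam (radius a b0 b D t))).

Variables (Delta um v : R).
Hypotheses (Delta_gt0 : 0 < Delta) (um_gt0 : 0 < um) (v_gt0 : 0 < v)
  (ups_um : forall u, enorm u <= Delta -> um <= ups u)
  (leb_v : forall y0, (v%:E <= leb (Cset h y0 Delta))%E).

Local Notation unn := (unnorm leb (trans f gam) (obs_lik h ups y)).

Let kappa (j : nat) : R := v * expR (- Zblock Delta (noise_block z e j.-1)).

Lemma trans_ge_in_Cset j x0 u : Cset h (y j) Delta x0 -> Cset h (y j.+1) Delta u ->
  expR (- Zblock Delta (noise_block z e j)) <= trans f gam x0 u.
Proof.
move=> Cx Cu; have D0 := ltW Delta_gt0.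
have rp : 0 <= radius a b0 b Delta (noise_block z e j) by exact: radius_ge0.
have [gp gle] := gamma_minusP gam_bounds rp.
rewrite /Zblock opprK lnK ?posrE//; apply: gle.
apply: (transition_radius E1 a0 b00 bge0 D0 (X0 := x j)).
- by rewrite -y_obs.
- by rewrite -x_dyn -y_obs.
Qed.

Lemma kappa_le j x0 : Cset h (y j) Delta x0 ->
  kappa j.+1 <= \int[leb]_u (trans f gam x0 u * \1_(Cset h (y j.+1) Delta) u).
Proof.
move=> Cx; set C := Cset _ _ _; have mC : measurable C by exact: measurable_Cset.
rewrite -lee_fin /Rintegral fineK; last first.
  apply: integrable_fin_num => //.
  exact: (integrable_indic_kernel (trans_ge0 f gam_density)
    (measurable_trans mf gam_density) (trans_mass f gam_density)).
set c := expR (- Zblock Delta (noise_block z e j)).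
apply: (@le_trans _ _ (\int[leb]_u (c%:E * (\1_C u)%:E))%E).
  rewrite ge0_integralZl_EFin ?expR_ge0//; last first.
    by apply/measurable_EFinP; exact: measurable_indic.
  rewrite integral_indic// setIT /kappa /= EFinM muleC.
  by apply: lee_wpmul2l; [rewrite lee_fin expR_ge0|exact: leb_v].
apply: le_integral_nonmeasurable => u.
  by rewrite -EFinM lee_fin mulr_ge0 ?expR_ge0.
rewrite -EFinM lee_fin indicE; have [/set_mem Cu|_] := boolP (u \in C).
  by rewrite !mulr1; exact: trans_ge_in_Cset.
by rewrite !mulr0.
Qed.

(** Only the trajectories that stay within [Delta] of the observations are
    counted: there the transition density is at least e^-Z, the likelihood at
    least [um], and the volume at least [v]. *)
Lemma unnorm_lower_bound (nu : probability X R) n :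
  um * \prod_(0 <= i < n) (um * v * expR (- Zblock Delta (noise_block z e i.+1))) *
    fine (nu_g_Q f h gam ups nu (y 0%N) (Cset h (y 1%N) Delta)) <=
  unn nu (fun=> 1) n.+1.
Proof.
rewrite (nu_g_QE mf mh gam_density ups_density upsM)//; last exact: measurable_Cset.
have kappa0 j : 0 <= kappa j by rewrite mulr_ge0 ?expR_ge0// ltW.
have um_le k u : Cset h (y k) Delta u -> um <= obs_lik h ups y k u.
  by move=> Cu; apply: ups_um; rewrite enormBC.
have := unnorm_ge (trans_ge0 f gam_density) (measurable_trans mf gam_density)
  (trans_mass f gam_density) (measurable_obs_lik mh ups_density y)
  (obs_lik_ge0 h ups_density y) (obs_lik_le h upsM y)
  (fun j => @measurable_Cset _ _ _ h mh (y j) Delta)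
  kappa0 (ltW um_gt0) um_le kappa_le nu n.
apply: le_trans; rewrite big_add1 /=.
by under [in leLHS]eq_bigr do rewrite -mulrA.
Qed.

Lemma ratio_contraction (m2 M2 P1 P2 theta : R) : 0 <= theta -> 0 < m2 ->
  theta <= m2 / M2 -> m2 <= P1 <= M2 -> m2 <= P2 <= M2 ->
  `|P1 - P2| <= expR (- theta) * (P1 + P2).
Proof.
move=> theta0 m20 thetaM.
wlog P12 : P1 P2 / P2 <= P1 => [wl P1b P2b|/andP[P1m P1M] /andP[P2m P2M]].
  have [P12|/ltW P12] := leP P2 P1; first exact: wl.
  by rewrite distrC [P1 + P2]addrC; exact: wl.
have M20 : 0 < M2 by exact: lt_le_trans (le_trans P1m P1M).
have tP1 : theta * P1 <= P2.
  apply: (@le_trans _ _ (theta * M2)); first by rewrite ler_wpM2l.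
  by move: thetaM; rewrite ler_pdivlMr// => /le_trans; exact.
have tP2 : theta * P2 <= P2 by apply: le_trans tP1; rewrite ler_wpM2l.
rewrite ger0_norm ?subr_ge0//.
apply: (@le_trans _ _ ((1 - theta) * (P1 + P2))); first by lra.
rewrite ler_wpM2r ?expR_ge1Dx//.
by rewrite addr_ge0// (le_trans (ltW m20)).
Qed.

Variables (l s theta D B : R).
Hypotheses (D0 : 0 <= D) (B0 : 0 <= B)
  (ups_off : forall u, D < enorm u -> ups u <= M * expR (- l)).

(** Inside the sets [Cset (y k) D], along a good transition, the arguments of
    [gam] stay in the ball of radius [good_radius]. *)
Definition good_radius : R :=
  2 * (a + 1) * b0 + (a + 1) * b * D + a * b * B + B + b * B.

Hypotheses (theta0 : 0 <= theta)
  (theta_le : theta <= fine (gamma_minus gam good_radius) ^+ 2 /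
                       fine (gamma_plus gam good_radius) ^+ 2)
  (s0 : 0 <= s) (s1 : s <= 1) (slE : s * l = 2 * theta).

Let good (j : nat) : bool := good_block B (noise_block z e j.-1).

Lemma trans_good k x0 u : good k.+1 -> Cset h (y k) D x0 -> Cset h (y k.+1) D u ->
  fine (gamma_minus gam good_radius) <= trans f gam x0 u <=
  fine (gamma_plus gam good_radius).
Proof.
move=> /and3P[/= g1 g2 g3] Cx Cu.
have r0 : 0 <= good_radius.
  by rewrite /good_radius !addr_ge0 ?mulr_ge0 ?addr_ge0.
have xr : enorm (u - f x0) <= good_radius.
  apply: (@le_trans _ _ (radius a b0 b D (noise_block z e k))).
    apply: (transition_radius E1 a0 b00 bge0 D0 (X0 := x k)).
    - by rewrite -y_obs.
    - by rewrite -x_dyn -y_obs.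
  have h1 : a * b * enorm (e k) <= a * b * B by rewrite ler_wpM2l ?mulr_ge0.
  have h2 : b * enorm (e k.+1) <= b * B by rewrite ler_wpM2l.
  rewrite /radius /good_radius /=; lra.
have [_ gm] := gamma_minusP gam_bounds r0.
by rewrite gm// (gamma_plusP gam_bounds r0).
Qed.

Let minorization k x0 x0' u u' : good k.+1 ->
  Cset h (y k) D x0 -> Cset h (y k) D x0' ->
  Cset h (y k.+1) D u -> Cset h (y k.+1) D u' ->
  `|trans f gam x0 u * trans f gam x0' u' - trans f gam x0 u' * trans f gam x0' u| <=
  expR (- theta) * (trans f gam x0 u * trans f gam x0' u' +
                    trans f gam x0 u' * trans f gam x0' u).
Proof.
move=> gk Cx Cx' Cu Cu'.
have r0 : 0 <= good_radius.
  by rewrite /good_radius !addr_ge0 ?mulr_ge0 ?addr_ge0.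
have [m0 _] := gamma_minusP gam_bounds r0.
have /andP[l1 u1] := trans_good gk Cx Cu.
have /andP[l2 u2] := trans_good gk Cx' Cu'.
have /andP[l3 u3] := trans_good gk Cx Cu'.
have /andP[l4 u4] := trans_good gk Cx' Cu.
apply: (ratio_contraction theta0 _ theta_le); first by rewrite exprn_gt0.
  by rewrite !expr2 !ler_pM// ?ltW// ?(lt_le_trans m0).
by rewrite !expr2 !ler_pM// ?ltW// ?(lt_le_trans m0).
Qed.

(** The effect of one transition: the first term is the contraction, the second
    one comes from the ratio between M^2 and the lower bounds of the two
    normalizing constants, raised to the power s. *)
Definition step_factor (t : Y * (X * Y)) : R :=
  expR (- theta * (good_block B t)%:R +
        s * (2 * ln M - 2 * ln um - 2 * ln v + 2 * Zblock Delta t)).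

Lemma ln_unnorm_ge (nu : probability X R) n :
  0 < fine (nu_g_Q f h gam ups nu (y 0%N) (Cset h (y 1%N) Delta)) ->
  0 < unn nu (fun=> 1) n.+1 /\
  ln um + \sum_(0 <= i < n) (ln um + ln v - Zblock Delta (noise_block z e i.+1)) +
    ln (fine (nu_g_Q f h gam ups nu (y 0%N) (Cset h (y 1%N) Delta))) <=
  ln (unn nu (fun=> 1) n.+1).
Proof.
set V := fine _ => V0; have := unnorm_lower_bound nu n; rewrite -/V.
set S := \sum_(0 <= i < n) _.
have -> : um * \prod_(0 <= i < n) (um * v *
    expR (- Zblock Delta (noise_block z e i.+1))) * V = expR (ln um + S + ln V).
  rewrite 2!expRD !lnK ?posrE// /S expR_sum; congr (_ * _ * _).
  by apply: eq_bigr => i _; rewrite 2!expRD !lnK ?posrE.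
move=> ZL; have Z0 := lt_le_trans (expR_gt0 _) ZL; split => //.
by rewrite -[leLHS]expRK ler_ln ?posrE ?expR_gt0.
Qed.

(** The contraction [tv_gap] uses the sets of the large radius [D], and the lower
    bound of the normalizing constants those of radius [Delta]. *)
Lemma path_tv_bound (nu nu' : probability X R) n :
  let V := fine (nu_g_Q f h gam ups nu (y 0%N) (Cset h (y 1%N) Delta)) in
  let V' := fine (nu_g_Q f h gam ups nu' (y 0%N) (Cset h (y 1%N) Delta)) in
  0 < V -> 0 < V' ->
  (tv_norm (fun A => filter_dist f h gam ups nu n.+1 y A -
                     filter_dist f h gam ups nu' n.+1 y A) <=
  (2 * (expR (s * (4 * ln M - 2 * ln um - ln V - ln V')) *
    \prod_(0 <= i < n) step_factor (noise_block z e i.+1)))%:E)%E.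
Proof.
move=> V V' V0 V0'.
have [Z0 ZV] := ln_unnorm_ge n V0; have [Z0' ZV'] := ln_unnorm_ge n V0'.
apply: ge_ereal_sup => _ [m [A [mA tA _ ->]]].
have -> : (\sum_(i < m) `|filter_dist f h gam ups nu n.+1 y (A i) -
      filter_dist f h gam ups nu' n.+1 y (A i)| =
    (\sum_(i < m) `|unn nu (\1_(A i)) n.+1 / unn nu (fun=> 1%R) n.+1 -
      unn nu' (\1_(A i)) n.+1 / unn nu' (fun=> 1%R) n.+1|%R)%:E)%E.
  rewrite -sumEFin; apply: eq_bigr => i _.
  by rewrite !(filter_distE mf mh gam_density ups_density upsM).
rewrite lee_fin.
have off k u : ~ Cset h (y k) D u -> obs_lik h ups y k u <= M * expR (- l).
  by move=> /negP; rewrite -ltNge enormBC; exact: ups_off.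
apply: le_trans (tv_gap (trans_ge0 f gam_density) (measurable_trans mf gam_density)
  (trans_mass f gam_density) (measurable_obs_lik mh ups_density y)
  (obs_lik_ge0 h ups_density y) (obs_lik_le h upsM y)
  theta0 s0 s1 slE (ltW M_gt0) off minorization M_gt0 mA tA Z0 Z0') _.
rewrite ler_wpM2l//.
set S := \sum_(0 <= i < n) (ln um + ln v - _) in ZV ZV'.
set G := \sum_(0 <= i < n) - theta * (good_block B (noise_block z e i.+1))%:R.
have decG : decay good theta 0 n.+1 <= expR G.
  rewrite /decay big_ltn// big_add1 /= expR_sum.
  apply: (@le_trans _ _ (1 * \prod_(0 <= i < n)
      (if good i.+2 then expR (- theta) else 1))).
    rewrite ler_wpM2r//; first by apply: prodr_ge0 => i _; case: ifP; rewrite ?expR_ge0.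
    by case: ifP => // _; rewrite -expR0 ler_expR oppr_le0.
  rewrite mul1r le_eqVlt; apply/orP; left; apply/eqP/eq_bigr => i _.
  by rewrite /good /=; case: good_block; rewrite ?mulr1 ?mulr0 ?expR0.
have -> : \prod_(0 <= i < n) step_factor (noise_block z e i.+1) =
    expR (G + s * (2 * ln M * n%:R - 2 * S)).
  rewrite /step_factor -expR_sum /G /S; congr expR.
  rewrite big_split /=; congr (_ + _); rewrite -mulr_sumr; congr (s * _).
  have -> : 2 * ln M * n%:R = \sum_(0 <= i < n) (2 * ln M).
    by rewrite sumr_const_nat subn0 mulr_natr.
  by rewrite mulr_sumr -sumrB; apply: eq_bigr => i _; ring.
rewrite -expRD; apply: (@le_trans _ _ (expR G *
    expR (s * (4 * ln M + 2 * ln M * n%:R - 2 * ln um - 2 * S - ln V - ln V')))).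
  apply: ler_pM; [exact: decay_ge0|exact: expR_ge0|exact: decG|].
  have n2 : (2 * n.+2)%:R = 4 + 2 * n%:R :> R.
    by rewrite natrM -!natr1; ring.
  rewrite ler_expR ler_wpM2l// -[ln M *+ _]mulr_natr n2 -/V -/V'.
  by move: ZV ZV'; rewrite -/V -/V'; lra.
rewrite -expRD ler_expR; lra.
Qed.

End path_bound.

(** * From an exponential bound to the growth rate *)

Section growth_rate.
Context {R : realType}.
Local Open Scope ereal_scope.

Lemma limsup_rate (u : nat -> \bar R) (K c : R) : (0 < K)%R -> (0 < c)%R ->
  (forall n, u n.+1 <= (K * expR (- c * n%:R))%:E) ->
  limn_esup (fun n : nat => (n%:R^-1)%:E * lne (u n)) < 0.
Proof.
move=> K0 c0 uK.
set A : R := (ln K + c)%R.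
pose n0 := (Num.truncn (2 * `|A| / c)%R).+1.
have An n : (n0 <= n)%N -> (A <= c / 2 * n%:R)%R.
  move=> n0n; have : (2 * `|A| / c < n%:R)%R.
    by rewrite (lt_le_trans (truncnS_gt _))// ler_nat.
  rewrite ltr_pdivrMr// => h; have := ler_norm A; lra.
apply: (@le_lt_trans _ _ (- (c / 2))%:E); last by rewrite lte_fin; lra.
pose V : set nat := [set n | (n0 <= n)%N].
have Voo : \oo V by exists n0.
apply: (le_trans (ereal_inf_lbound _)); first by exists V.
apply: ge_ereal_sup => _ [n n0n <-].
have n_gt0 : (0 < n)%N by exact: leq_trans n0n.
have lu : lne (u n) <= (A - c * n%:R)%:E.
  have -> : n = n.-1.+1 by rewrite prednK.
  have := uK n.-1; case: (u _) => [r| |]; last by move=> _; rewrite /= leNye.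
    rewrite lee_fin /= => rK; case: ifPn => [_|]; first by rewrite leNye.
    rewrite -ltNge => r0; rewrite lee_fin.
    have -> : (A - c * n.-1.+1%:R)%R = ln (K * expR (- c * n.-1%:R)).
      rewrite lnM ?posrE ?expR_gt0// expRK /A -natr1; ring.
    by rewrite ler_ln ?posrE// mulr_gt0 ?expR_gt0.
  by rewrite leye_eq.
apply: (@le_trans _ _ ((n%:R^-1)%:E * (A - c * n%:R)%:E)).
  by apply: lee_wpmul2l => //; rewrite lee_fin invr_ge0.
rewrite -EFinM lee_fin mulrC ler_pdivrMr ?ltr0n//.
by have := An n n0n; lra.
Qed.

End growth_rate.

(** * Measurability of the random bounds *)

Section measurability.
Context {R : realType} (N p : nat).
Local Notation X := 'rV[R]_N.
Local Notation Y := 'rV[R]_p.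
Local Notation leb := (@lebesgue_rV R N).
Variables (f : X -> X) (h : X -> Y) (gam : X -> R) (ups : Y -> R).
Hypotheses (mf : measurable_fun setT f) (mh : measurable_fun setT h)
  (gam_density : positive_density gam) (ups_density : positive_density ups).

Lemma measurable_Cset_graph Delta :
  measurable [set yu : Y * X | Cset h yu.1 Delta yu.2].
Proof.
have mC : measurable_fun setT (fun yu : Y * X => enorm (h yu.2 - yu.1)).
  apply: (measurableT_comp (@measurable_enorm _ _)).
  by apply: measurable_subrow => //; exact: measurableT_comp.
have := mC measurableT `]-oo, Delta]%classic (measurable_itv _).
by rewrite setTI (_ : _ @^-1` _ = [set yu : Y * X | Cset h yu.1 Delta yu.2]).
Qed.

Lemma measurable_nu_g_Q (nu : probability X R) Delta :
  measurable_fun setT (fun yy : Y * Y =>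
    nu_g_Q f h gam ups nu yy.1 (Cset h yy.2 Delta)).
Proof.
have mt := measurable_trans mf gam_density.
pose G (yxu : (Y * X) * X) : \bar R :=
  (trans f gam yxu.1.2 yxu.2 * \1_[set yu : Y * X | Cset h yu.1 Delta yu.2]
    (yxu.1.1, yxu.2))%:E.
have mG : measurable_fun setT G.
  have m1 : measurable_fun setT (fun z : (Y * X) * X => (z.1.2, z.2)).
    by apply: measurable_fun_pair => //; exact: measurableT_comp.
  have m2 : measurable_fun setT (fun z : (Y * X) * X => (z.1.1, z.2)).
    by apply: measurable_fun_pair => //; exact: measurableT_comp.
  apply/measurable_EFinP; apply: measurable_funM.
    exact: (measurableT_comp mt m1).
  have mI : measurable_fun setT
      (\1_[set yu : Y * X | Cset h yu.1 Delta yu.2] : Y * X -> R).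
    by apply: measurable_indic; exact: measurable_Cset_graph.
  exact: (measurableT_comp mI m2).
have G0 z : (0 <= G z)%E by rewrite lee_fin mulr_ge0// trans_ge0.
have mQ : measurable_fun setT (fun yx : Y * X => Qker f gam yx.2 (Cset h yx.1 Delta)).
  have := @measurable_fun_fubini_tonelli_F _ _ _ _ _ leb G mG G0.
  apply: eq_measurable_fun => -[y0 x0] _.
  rewrite /fubini_F /Qker [RHS]integral_mkcond; apply: eq_integral => u _.
  rewrite patchE /G /= indicE.
  rewrite (_ : ((y0, u) \in _) = (u \in Cset h y0 Delta)); last by apply/idP/idP => /set_mem H; apply/mem_set.
  by case: (_ \in _); rewrite ?mulr1 ?mulr0.
pose H (yyx : (Y * Y) * X) : \bar R :=
  ((lik h ups yyx.2 yyx.1.1)%:E * Qker f gam yyx.2 (Cset h yyx.1.2 Delta))%E.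
have mH : measurable_fun setT H.
  apply: emeasurable_funM.
    apply/measurable_EFinP.
    have m1 : measurable_fun setT (fun z : (Y * Y) * X => (z.2, z.1.1)).
      by apply: measurable_fun_pair => //; exact: measurableT_comp.
    exact: (measurableT_comp (measurable_lik2 mh ups_density) m1).
  have m2 : measurable_fun setT (fun z : (Y * Y) * X => (z.1.2, z.2)).
    by apply: measurable_fun_pair => //; exact: measurableT_comp.
  exact: (measurableT_comp mQ m2).
have H0 z : (0 <= H z)%E.
  apply: mule_ge0; first by rewrite lee_fin ltW// (lik_gt0 h ups_density).
  rewrite /Qker; apply: integral_ge0 => u _; rewrite lee_fin.
  exact: (trans_ge0 f gam_density).
exact: (@measurable_fun_fubini_tonelli_F _ _ _ _ _ nu H mH H0).
Qed.

Lemma measurable_exp_negpart (lam : R) :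
  measurable_fun setT (fun v : R => expeR (lam%:E * negpart (lne v%:E))%E).
Proof.
have -> : (fun v : R => expeR (lam%:E * negpart (lne v%:E))%E) =
    (fun v => if v <= 0 then expeR (lam%:E * +oo)%E
              else (expR (lam * Num.max (- ln v) 0))%:E).
  apply/funext => v; rewrite /negpart /=; case: ifPn => // _.
  by rewrite -EFinN -EFin_max -EFinM.
apply: measurable_fun_ifT.
- exact: measurable_fun_ler.
- exact: measurable_cst.
- apply/measurable_EFinP; apply: measurableT_comp => //.
  apply: measurable_funM => //; apply: measurable_maxr => //.
  by apply: measurable_funN; exact: measurable_ln.
Qed.

Variables (a b0 b : R).
Hypotheses (a0 : 0 <= a) (b00 : 0 <= b0) (bge0 : 0 <= b).
Hypothesis gam_bounds : forall r : R, 0 <= r ->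
  [/\ (0 < gamma_minus gam r)%E, (gamma_minus gam r <= gamma_plus gam r)%E
    & (gamma_plus gam r < +oo)%E].

Lemma measurable_Zblock D : 0 <= D ->
  measurable_fun setT (Zblock gam a b0 b D : Y * (X * Y) -> R).
Proof.
move=> D0; apply: (@eq_measurable_fun _ _ (Y * (X * Y))%type R setT
  (fun t => - ln (fine (gamma_minus gam (Num.max (radius a b0 b D t) 0))))).
  by move=> t _; rewrite (max_idPl (radius_ge0 _ _ _ _ _)).
apply: measurable_funN; apply: (measurableT_comp (@measurable_ln _)).
apply: (measurableT_comp (measurable_gamma_minus gam_bounds)).
exact: measurable_radius.
Qed.

Lemma measurable_good_block (B : R) :
  measurable [set t : Y * (X * Y) | good_block B t].
Proof.
have -> : [set t : Y * (X * Y) | good_block B t] =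
    (fun t => enorm t.1) @^-1` `]-oo, B] `&`
    ((fun t => enorm t.2.1) @^-1` `]-oo, B] `&`
     (fun t => enorm t.2.2) @^-1` `]-oo, B]).
  apply/seteqP; split => t; rewrite /good_block /= !in_itv /=.
    by move=> /and3P[].
  by move=> [-> [-> ->]].
have mE d (T : measurableType d) n (u : T -> 'rV[R]_n) :
    measurable_fun setT u -> measurable ((fun t => enorm (u t)) @^-1` `]-oo, B]).
  move=> mu; rewrite -[X in measurable X]setTI.
  exact: (measurableT_comp (@measurable_enorm _ _) mu) (measurable_itv _).
apply: measurableI; first exact: mE.
by apply: measurableI; apply: mE; apply: measurableT_comp.
Qed.

Lemma measurable_step_factor M Delta um v s theta B : 0 <= Delta ->
  measurable_fun setT
    (step_factor gam M a b0 b Delta um v s theta B : Y * (X * Y) -> R).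
Proof.
move=> D0; apply: measurableT_comp => //; apply: measurable_funD.
  apply: measurable_funM => //.
  apply: (@eq_measurable_fun _ _ (Y * (X * Y))%type R setT
    (\1_[set t : Y * (X * Y) | good_block B t])).
    move=> t _; rewrite indicE.
    have [/set_mem|/negP] := boolP (t \in [set t | good_block B t]); first by move=> ->.
    by move=> ng; rewrite (_ : good_block B t = false)//; apply/negP => g; apply: ng; exact/mem_set.
  by apply: measurable_indic; exact: measurable_good_block.
apply: measurable_funM => //; apply: measurable_funD => //.
by apply: measurable_funM => //; exact: measurable_Zblock.
Qed.

End measurability.

(** * Products over consecutive transitions *)

Section noise_products.
Context d (W : measurableType d) (R : realType) (P : probability W R).
Context d1 d2 (X : measurableType d1) (Y : measurableType d2).
Variables (zeta : nat -> {RV P >-> X}) (eps : nat -> {RV P >-> Y}).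
Hypotheses (zeta_indep : independent_seq P zeta)
  (eps_indep : independent_seq P eps)
  (zeta_eps_indep :
     independent_classes P <<s events zeta >> <<s events eps >>)
  (zeta_law : forall k B, measurable B -> P (zeta k @^-1` B) = P (zeta 1%N @^-1` B))
  (eps_law : forall k B, measurable B -> P (eps k @^-1` B) = P (eps 0%N @^-1` B)).

Local Notation block k w := (eps k w, (zeta k.+1 w, eps k.+1 w)).

(** The sources of randomness of the k-th block. *)
Definition block_index (k : nat) : seq (nat + nat) := [:: inl k; inr k.+1; inl k.+1].

Lemma block_index_uniq c n :
  uniq (flatten (mkseq (fun i => block_index (2 * i + c)) n)).
Proof.
elim: n => // n IH; rewrite mkseqS flatten_rcons cat_uniq IH.
have lt i : i \in flatten (mkseq (fun i => block_index (2 * i + c)) n) ->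
    match i with inl k | inr k => (k < 2 * n + c)%N end.
  move=> /flattenP[s /mapP[j]]; rewrite mem_iota => jn ->.
  by rewrite !inE => /or3P[]/eqP ->; lia.
rewrite andTb; apply/andP; split.
  apply/hasPn => i; rewrite /= !inE => /or3P[]/eqP ->; apply/negP => /lt; lia.
by rewrite /= !inE /= !andbT; apply/eqP => -[]; lia.
Qed.

Lemma integral_prod_noise (F : Y * (X * Y) -> R) (rho : R) c n :
  measurable_fun setT F -> (forall t, 0 <= F t) ->
  (\int[P]_w (F (block 0%N w))%:E <= rho%:E)%E ->
  (\int[P]_w (\prod_(i < n) F (block (2 * i + c)%N w))%:E <= (rho ^+ n)%:E)%E.
Proof.
move=> mF F0 Frho.
apply: (@integral_prod_blocks _ _ _ P _ (noise_events zeta eps) _ _ _ _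
  (fun i => block_index (2 * i + c))
  (fun i w => F (block (2 * i + c)%N w))) => //.
- exact: noise_events_measurable.
- exact: noise_eventsI.
- exact: noise_eventsT.
- exact: noise_independent.
- exact: block_index_uniq.
- move=> i; set k := (2 * i + c)%N.
  have mb : measurable_fun
      (setT : set (sub_field (noise_events zeta eps) (block_index k)))
      (fun w => block k w).
    apply: measurable_fun_pair.
      by apply: measurable_eps_sub_field; rewrite !inE eqxx.
    apply: measurable_fun_pair.
      by apply: measurable_zeta_sub_field; rewrite !inE eqxx orbT.
    by apply: measurable_eps_sub_field; rewrite !inE eqxx !orbT.
  exact: (measurableT_comp mF mb).
- move=> i; apply: le_trans Frho.
  have := @integral_noise_block0 _ _ _ _ _ _ _ _ _ _ zeta_indep eps_indep
    zeta_eps_indep (2 * i + c)%N (EFin \o F).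
  by move=> /(_ (zeta_law _) eps_law) -> //; exact/measurable_EFinP.
Qed.

Lemma prod_even_odd (psi : nat -> R) m :
  \prod_(0 <= j < m) psi j =
  (\prod_(i < uphalf m) psi (2 * i)%N) * (\prod_(i < m./2) psi (2 * i).+1).
Proof.
elim: m => [|m IH]; first by rewrite big_geq// !big_ord0 mulr1.
rewrite big_nat_recr//= IH; have := odd_double_half m.
rewrite uphalf_half; case: (odd m) => /= mE; rewrite ?add1n ?add0n.
  rewrite [X in _ = _ * X]big_ord_recr /= mulrA; congr (_ * psi _); lia.
rewrite [X in _ = X * _]big_ord_recr /= mulrAC; congr (_ * psi _ * _); lia.
Qed.

(** Consecutive blocks share one noise, but blocks two apart are independent. The
    product is therefore split by parity, using (A B)^2 <= (A^4 + B^4) / 2. *)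
Lemma integral_prod_sqr (G : Y * (X * Y) -> R) (rho : R) m :
  measurable_fun setT G -> (forall t, 0 <= G t) -> 0 <= rho -> rho <= 1 ->
  (\int[P]_w (G (block 0%N w) ^+ 4)%:E <= rho%:E)%E ->
  (\int[P]_w ((\prod_(0 <= j < m) G (block j.+1 w)) ^+ 2)%:E
     <= (rho ^+ m./2)%:E)%E.
Proof.
move=> mG G0 rho0 rho1 Grho.
have mF : measurable_fun setT (fun t => G t ^+ 4) by exact: measurable_funX.
have F0 t : 0 <= G t ^+ 4 by rewrite exprn_ge0.
pose ev w := \prod_(i < uphalf m) G (block (2 * i + 1)%N w) ^+ 4.
pose od w := \prod_(i < m./2) G (block (2 * i + 2)%N w) ^+ 4.
have mblock k : measurable_fun setT (fun w => G (block k w) ^+ 4).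
  apply: (measurableT_comp mF); apply: measurable_fun_pair => //.
  exact: measurable_fun_pair.
have mev : measurable_fun setT ev.
  exact: (measurable_prod_ord (phi := fun i w => G (block (2 * i + 1)%N w) ^+ 4)).
have mod_ : measurable_fun setT od.
  exact: (measurable_prod_ord (phi := fun i w => G (block (2 * i + 2)%N w) ^+ 4)).
have ev0 w : 0 <= ev w by apply: prodr_ge0.
have od0 w : 0 <= od w by apply: prodr_ge0.
have evE := integral_prod_noise 1 (uphalf m) mF F0 Grho.
have odE := integral_prod_noise 2 (m./2) mF F0 Grho.
apply: (@le_trans _ _ (\int[P]_w ((2^-1)%:E * ((ev w)%:E + (od w)%:E)))%E).
  apply: le_integral_nonmeasurable => w; first by rewrite lee_fin sqr_ge0.
  rewrite -EFinD -EFinM lee_fin prod_even_odd.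
  set A := \prod_(i < uphalf m) _; set B := \prod_(i < m./2) _.
  have -> : ev w = A ^+ 4.
    rewrite /ev /A -prodrXl; apply: eq_bigr => i _.
    by rewrite addn1.
  have -> : od w = B ^+ 4.
    rewrite /od /B -prodrXl; apply: eq_bigr => i _.
    by rewrite addn2.
  have := sqr_ge0 (A ^+ 2 - B ^+ 2); rewrite exprMn; lra.
rewrite ge0_integralZl_EFin//; last 2 first.
- by move=> w _; rewrite adde_ge0// lee_fin.
- by apply: emeasurable_funD; apply/measurable_EFinP.
rewrite ge0_integralD//; last 4 first.
- by move=> w _; rewrite lee_fin.
- exact/measurable_EFinP.
- by move=> w _; rewrite lee_fin.
- exact/measurable_EFinP.
apply: (@le_trans _ _ ((2^-1)%:E * ((rho ^+ m./2)%:E + (rho ^+ m./2)%:E))%E).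
  rewrite lee_wpmul2l// leeD// (le_trans evE)// lee_fin ler_wiXn2l//.
  by rewrite uphalf_half leq_addl.
by rewrite -EFinD -EFinM lee_fin; lra.
Qed.

End noise_products.

(** * Exponential decay of the expected total variation *)

Section negative_moments.
Context {R : realType}.

Lemma exp_negpart_ge (lam t v : R) : 0 < v -> 0 <= t -> t <= lam ->
  ((expR (- t * ln v))%:E <= expeR (lam%:E * negpart (lne v%:E)))%E.
Proof.
move=> v0 t0 tlam; rewrite lne_EFin// /negpart -EFinN -EFin_max -EFinM /= lee_fin.
rewrite ler_expR mulNr -mulrN; apply: (@le_trans _ _ (t * Num.max (- ln v) 0)).
  by rewrite ler_wpM2l// le_max lexx.
by rewrite ler_wpM2r// le_max lexx orbT.
Qed.

Lemma exp_negpart_oo (lam : R) (v : \bar R) : 0 < lam -> (v <= 0)%E ->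
  (expeR (lam%:E * negpart (lne v)) = +oo)%E.
Proof.
move=> lam0 v0; rewrite le0_lneNy// /negpart /=.
by rewrite maxye gt0_muley ?lte_fin.
Qed.

End negative_moments.

Lemma tv_norm_ge0 d (T : measurableType d) (R : realType) (mu : set T -> \bar R) :
  (0 <= tv_norm mu)%E.
Proof.
apply: (@le_trans _ _ `|mu setT|%E); first exact: abse_ge0.
apply: ereal_sup_ubound; exists 1%N, (fun=> setT); split => //.
- by move=> i j _ _ _; rewrite (ord1 i) (ord1 j).
- by rewrite bigcup_const//; exists ord0.
- by rewrite big_ord1.
Qed.

Section exponential_bound.
Context (R : realType) (N p : nat).
Local Notation X := 'rV[R]_N.
Local Notation Y := 'rV[R]_p.
Variables (f : X -> X) (h : X -> Y) (gam : X -> R) (ups : Y -> R).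
Hypotheses (mf : measurable_fun setT f) (mh : measurable_fun setT h)
  (gam_density : positive_density gam) (ups_density : positive_density ups).
Hypothesis gam_bounds : forall r : R, 0 <= r ->
  [/\ (0 < gamma_minus gam r)%E, (gamma_minus gam r <= gamma_plus gam r)%E
    & (gamma_plus gam r < +oo)%E].
Context d (W : measurableType d) (P : probability W R).
Variables (x : nat -> W -> X) (y : nat -> W -> Y).
Variables (zeta : nat -> {RV P >-> X}) (eps : nat -> {RV P >-> Y}).
Hypotheses (mx0 : measurable_fun setT (x 0%N))
  (zeta_indep : independent_seq P zeta) (eps_indep : independent_seq P eps)
  (zeta_eps_indep :
     independent_classes P <<s events zeta >> <<s events eps >>)
  (zeta_law : forall k B, measurable B -> P (zeta k @^-1` B) = P (zeta 1%N @^-1` B))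
  (eps_law : forall k B, measurable B -> P (eps k @^-1` B) = P (eps 0%N @^-1` B))
  (x_dyn : forall k w, x k.+1 w = f (x k w) + zeta k.+1 w)
  (y_obs : forall k w, y k w = h (x k w) + eps k w).
Variables (a b0 b : R).
Hypotheses (a0 : 0 <= a) (b00 : 0 <= b0) (bge0 : 0 <= b)
  (E1 : assumption_E1 f h a b0 b) (E2 : assumption_E2 ups).
Variables (Delta tau lam : R) (nu nu' : probability X R).
Hypotheses (Delta_gt0 : 0 < Delta) (tau_gt0 : 0 < tau) (lam_gt0 : 0 < lam)
  (Z_mgf : (\int[P]_w (expR (tau * Zvar gam zeta eps a b0 b Delta 1 w))%:E < +oo)%E).

Let one_step (mu : probability X R) (w : W) : \bar R :=
  nu_g_Q f h gam ups mu (y 0%N w) (Cset h (y 1%N w) Delta).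
Let moment (mu : probability X R) (w : W) : \bar R :=
  expeR (lam%:E * negpart (lne (one_step mu w))).
Let block (k : nat) (w : W) : Y * (X * Y) := noise_block (zeta^~ w) (eps^~ w) k.

Hypotheses (moment_nu : (\int[P]_w moment nu w < +oo)%E)
  (moment_nu' : (\int[P]_w moment nu' w < +oo)%E).

Let mblock k : measurable_fun setT (block k).
Proof. by apply: measurable_fun_pair => //; exact: measurable_fun_pair. Qed.

Let my k : measurable_fun setT (x k) -> measurable_fun setT (y k).
Proof.
move=> mx; have -> : y k = fun w => h (x k w) + eps k w by apply/funext.
by apply: measurable_sumrow => //; exact: measurableT_comp.
Qed.

Let measurable_one_step mu : measurable_fun setT (one_step mu).
Proof.
have mx1 : measurable_fun setT (x 1%N).
  have -> : x 1%N = fun w => f (x 0%N w) + zeta 1%N w by apply/funext.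
  by apply: measurable_sumrow => //; exact: measurableT_comp.
have my01 : measurable_fun setT (fun w => (y 0%N w, y 1%N w)).
  by apply: measurable_fun_pair; exact: my.
exact: (measurableT_comp
  (measurable_nu_g_Q mf mh gam_density ups_density mu Delta) my01).
Qed.

Let one_step_fin mu w : one_step mu w = (fine (one_step mu w))%:E.
Proof.
have ups0 u : 0 < ups u by have [_ + _] := ups_density.
have [M M0 upsM] := ups_bounded E2 ups0.
have mC : measurable (Cset h (y 1%N w) Delta) by exact: measurable_Cset.
have := nu_g_QE mf mh gam_density ups_density upsM (y^~ w) mu mC.
by rewrite /= -/(one_step mu w) => ->.
Qed.

Let measurable_moment mu : measurable_fun setT (moment mu).
Proof.
have -> : moment mu = (fun v : R => expeR (lam%:E * negpart (lne v%:E))%E) \o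
    (fine \o one_step mu).
  by apply/funext => w; rewrite /moment one_step_fin.
apply: (measurableT_comp (measurable_exp_negpart lam)).
by apply: measurableT_comp => //; exact: fine_measurable.
Qed.

Let moment_ge0 mu w : (0 <= moment mu w)%E.
Proof. exact: expeR_ge0. Qed.

(** The order in which the constants are chosen matters: l and B make the mean
    exponent of a step negative, D depends on l, and theta is taken small with
    respect to all of them; s = 2 theta / l then makes the powers of the
    normalizing constants integrable. *)
Lemma exponential_bound : exists K c, [/\ 0 < K, 0 < c & forall n,
  (\int[P]_w tv_norm (fun A => filter_dist f h gam ups nu n.+1 (y^~ w) A -
                               filter_dist f h gam ups nu' n.+1 (y^~ w) A)
   <= (K * expR (- c * n%:R))%:E)%E].
Proof.
have ups0 u : 0 < ups u by have [_ + _] := ups_density.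
have [M M_gt0 upsM] := ups_bounded E2 ups0.
have [um um_gt0 ups_um] := ups_minorized E2 (ltW Delta_gt0).
have [v v_gt0 leb_v] := lebesgue_Cset mh E1 Delta_gt0.
set C2 := 2 * ln M - 2 * ln um - 2 * ln v.
pose Z1 w := Zblock gam a b0 b Delta (block 0 w).
pose bad (n : nat) : set W := [set w | ~ good_block n%:R (block 0 w)].
have mZ1 : measurable_fun setT Z1.
  exact: (measurableT_comp (measurable_Zblock a0 b00 bge0 gam_bounds (ltW Delta_gt0))
    (mblock 0)).
have mbad n : measurable (bad n).
  apply: measurableC; rewrite -[X in measurable X]setTI.
  exact: (mblock 0 measurableT (measurable_good_block n%:R)).
have nibad : nonincreasing_seq bad.
  move=> n m nm; apply/subsetPset => w; apply: contra_not.
  by move=> /and3P[g1 g2 g3]; apply/and3P; split;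
    rewrite (le_trans g1, le_trans g2, le_trans g3)// ler_nat.
have bad0 : \bigcap_n bad n = set0.
  apply/seteqP; split => // w wbad.
  pose S := enorm (block 0 w).1 + enorm (block 0 w).2.1 + enorm (block 0 w).2.2.
  pose n := (Num.truncn S).+1.
  have Sn : S < n%:R by exact: truncnS_gt.
  have e1 := enorm_ge0 (block 0 w).1; have e2 := enorm_ge0 (block 0 w).2.1.
  have e3 := enorm_ge0 (block 0 w).2.2.
  by apply: (wbad n I); apply/and3P; split; move: Sn; rewrite /S; lra.
have [l [nB [l_gt0 stepE]]] :=
  step_moment (P := P) (2 * C2) mZ1 tau_gt0 Z_mgf mbad nibad bad0.
have [D D0 ups_off] := ups_vanishes E2 (mulr_gt0 M_gt0 (expR_gt0 (- l))).
pose B : R := nB%:R.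
pose ratio := fine (gamma_minus gam (good_radius a b0 b D B)) ^+ 2 /
              fine (gamma_plus gam (good_radius a b0 b D B)) ^+ 2.
have ratio_gt0 : 0 < ratio.
  have r0 : 0 <= good_radius a b0 b D B.
    by rewrite /good_radius !addr_ge0 ?mulr_ge0 ?addr_ge0.
  have [gm_gt0 gm] := gamma_minusP gam_bounds r0.
  have gp := gamma_plusP gam_bounds r0.
  rewrite divr_gt0// exprn_gt0//.
  apply: (lt_le_trans gm_gt0); apply: (@le_trans _ _ (gam 0)).
    by apply: gm; rewrite enorm0.
  by apply: gp; rewrite enorm0.
pose theta := Num.min (Num.min 4^-1 ratio) (Num.min (l / 2) (lam * l / 8)).
have theta_gt0 : 0 < theta.
  by rewrite !lt_min ratio_gt0 !divr_gt0 ?mulr_gt0// invr_gt0 ltr0n.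
have [th1 th2 th3 th4] : [/\ theta <= 4^-1, theta <= ratio, theta <= l / 2
    & theta <= lam * l / 8].
  by split; rewrite !ge_min ?lexx ?orbT.
have theta0 := ltW theta_gt0; have l0 := ltW l_gt0.
pose s := 2 * theta / l.
have s0 : 0 <= s by rewrite divr_ge0// mulr_ge0.
have s1 : s <= 1 by rewrite ler_pdivrMr//; move: th3; lra.
have slE : s * l = 2 * theta by rewrite /s mulfVK// gt_eqF.
have s4 : 4 * s <= lam by rewrite /s mulrA ler_pdivrMr//; move: th4; lra.
pose G := step_factor gam M a b0 b Delta um v s theta B : Y * (X * Y) -> R.
have mG : measurable_fun setT G.
  by apply: measurable_step_factor => //; exact: ltW.
have G0 t : 0 <= G t by exact: expR_ge0.
have G4 : (\int[P]_w (G (block 0 w) ^+ 4)%:E <= (expR (- (3 * theta)))%:E)%E.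
  have G4E w : G (block 0 w) ^+ 4 = expR (- (4 * theta)) *
      expR (4 * theta * (\1_(bad nB) w + 2 * C2 / l + 4 * Z1 w / l)).
    rewrite /G /step_factor -expRM_natl -expRD; congr expR.
    have -> : (good_block B (block 0 w))%:R = 1 - \1_(bad nB) w :> R.
      rewrite indicE /B; have [g|ng] := boolP (good_block nB%:R (block 0 w)).
        rewrite (_ : (w \in bad nB) = false) ?subr0//.
        by apply/negP => /set_mem; apply.
      by rewrite mem_set ?subrr//; exact/negP.
    rewrite /s -/C2 -/(Z1 w); field; rewrite gt_eqF//.
  under eq_integral do rewrite G4E EFinM.
  rewrite ge0_integralZl_EFin ?expR_ge0//; last first.
    apply/measurable_EFinP; apply: measurableT_comp => //.
    apply: measurable_funM => //; apply: measurable_funD; last first.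
      by apply: measurable_funM => //; exact: measurable_funM.
    by apply: measurable_funD => //; exact: measurable_indic.
  apply: (@le_trans _ _ ((expR (- (4 * theta)))%:E * (1 + theta)%:E)%E).
    by apply: lee_wpmul2l; [rewrite lee_fin expR_ge0|exact: stepE].
  rewrite -EFinM lee_fin; apply: (@le_trans _ _ (expR (- (4 * theta)) * expR theta)).
    by rewrite ler_wpM2l ?expR_ge0// expR_ge1Dx.
  by rewrite -expRD ler_expR; lra.
pose x_ (n : nat) w := \prod_(0 <= j < n) G (block j.+1 w).
have mx_ n : measurable_fun setT (x_ n).
  rewrite /x_; under eq_fun do rewrite big_mkord.
  apply: (measurable_prod_ord (phi := fun j w => G (block j.+1 w))) => j _.
  exact: (measurableT_comp mG (mblock j.+1)).
have x_sqr n : (\int[P]_w (x_ n w ^+ 2)%:E <=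
    (expR (3 * theta / 2) * expR (- (3 * theta / 2) * n%:R))%:E)%E.
  have e1 : expR (- (3 * theta)) <= 1 by rewrite -[leRHS]expR0 ler_expR; lra.
  apply: (le_trans (integral_prod_sqr zeta_indep eps_indep zeta_eps_indep
    zeta_law eps_law n mG G0 (expR_ge0 _) e1 G4)).
  rewrite lee_fin -expRM_natl -expRD ler_expR.
  have n_half : n%:R <= 2 * (n./2)%:R + 1 :> R.
    rewrite -natrM natr1 ler_nat mul2n -[X in (X <= _)%N]odd_double_half -add1n.
    by rewrite leq_add2r leq_b1.
  have th32 : 0 <= 3 * theta / 2 by rewrite divr_ge0// mulr_ge0.
  by have := ler_wpM2l th32 n_half; lra.
pose c0 := 4 * ln M - 2 * ln um.
pose up (n : nat) := expR (theta / 2 * n%:R).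
pose dn (n : nat) := expR (- (theta / 2) * n%:R).
(* 2 X Y <= r^2 X^2 + Y^2 / r^2, where Y^2 is in turn bounded by a mean of fourth
   powers; r^4 = e^(theta n) balances the decay of the mean of X^2. *)
have weighted_product n (X0 u u' : R) :
    2 * (expR (s * (c0 - u - u')) * X0) <= expR (s * c0) * (up n * X0 ^+ 2 +
      dn n / 2 * (expR (- (4 * s) * u) + expR (- (4 * s) * u'))).
  set al := expR (- s * u); set be := expR (- s * u').
  pose r := expR (theta / 4 * n%:R); pose r' := expR (- (theta / 4) * n%:R).
  have rr : r * r' = 1 by rewrite /r /r' -expRD -[RHS]expR0; congr expR; ring.
  have -> : up n = r ^+ 2 by rewrite /up /r -expRM_natl; congr expR; field.
  have -> : dn n = r' ^+ 2 by rewrite /dn /r' -expRM_natl; congr expR; field.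
  have -> : expR (- (4 * s) * u) = al ^+ 4 by rewrite /al -expRM_natl; congr expR; ring.
  have -> : expR (- (4 * s) * u') = be ^+ 4 by rewrite /be -expRM_natl; congr expR; ring.
  have -> : expR (s * (c0 - u - u')) = expR (s * c0) * (al * be).
    by rewrite /al /be -!expRD; congr expR; ring.
  rewrite [leLHS](_ : _ = expR (s * c0) * (2 * ((r * X0) * (r' * (al * be))))); last first.
    rewrite [r * X0 * _](_ : _ = r * r' * (X0 * (al * be))); last by ring.
    by rewrite rr; ring.
  rewrite ler_wpM2l ?expR_ge0//.
  have h1 := sqr_ge0 (r * X0 - r' * (al * be)).
  have h2 : 0 <= r' ^+ 2 * (al ^+ 2 - be ^+ 2) ^+ 2 by rewrite mulr_ge0 ?sqr_ge0.
  by move: h1 h2; nra.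
pose bound n w : \bar R := ((expR (s * c0))%:E * ((up n * x_ n w ^+ 2)%:E +
    (dn n / 2)%:E * (moment nu w + moment nu' w)))%E.
have dn_gt0 n : 0 < dn n / 2 by rewrite divr_gt0 ?expR_gt0.
have pathwise n w : (tv_norm (fun A => filter_dist f h gam ups nu n.+1 (y^~ w) A -
    filter_dist f h gam ups nu' n.+1 (y^~ w) A) <= bound n w)%E.
  have boundy : (moment nu w + moment nu' w = +oo)%E -> bound n w = +oo%E.
    move=> my_; rewrite /bound my_ gt0_muley ?lte_fin// addey//.
    by rewrite gt0_muley ?lte_fin ?expR_gt0.
  have [V0|V0] := leP (one_step nu w) 0%E.
    (* The logarithm is then infinite, and so is the bound. *)
    rewrite boundy ?leey// /moment (exp_negpart_oo lam_gt0 V0) addye//.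
    by rewrite gt_eqF// (lt_le_trans _ (expeR_ge0 _)).
  have [V0'|V0'] := leP (one_step nu' w) 0%E.
    rewrite boundy ?leey// /moment (exp_negpart_oo lam_gt0 V0') addey//.
    by rewrite gt_eqF// (lt_le_trans _ (expeR_ge0 _)).
  rewrite one_step_fin lte_fin in V0; rewrite one_step_fin lte_fin in V0'.
  apply: (le_trans (path_tv_bound mf mh gam_density ups_density M_gt0 upsM gam_bounds
    E1 a0 b00 bge0 (x := x^~ w) (z := zeta^~ w) (e := eps^~ w) (y := y^~ w)
    (fun k => x_dyn k w) (fun k => y_obs k w) Delta_gt0 um_gt0 v_gt0 ups_um leb_v
    (l := l) (s := s) (theta := theta) (B := B) D0 (ler0n _ _) ups_off theta0 th2
    s0 s1 slE n V0 V0')).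
  rewrite -/(one_step nu w) -/(one_step nu' w).
  set V := fine (one_step nu w) in V0 *; set V' := fine (one_step nu' w) in V0' *.
  apply: (@le_trans _ _ ((expR (s * c0) * (up n * x_ n w ^+ 2 +
      dn n / 2 * (expR (- (4 * s) * ln V) + expR (- (4 * s) * ln V'))))%:E)).
    by rewrite lee_fin; exact: weighted_product.
  rewrite EFinM EFinD [(dn n / 2 * _)%:E]EFinM EFinD.
  apply: lee_wpmul2l; first by rewrite lee_fin expR_ge0.
  apply: leeD2l; apply: lee_wpmul2l; first by rewrite lee_fin ltW.
  have s4' : 0 <= 4 * s by rewrite mulr_ge0.
  apply: leeD; rewrite /moment one_step_fin; exact: exp_negpart_ge.
pose m := fine (\int[P]_w moment nu w); pose m' := fine (\int[P]_w moment nu' w).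
have mE : (\int[P]_w moment nu w = m%:E)%E.
  by rewrite /m fineK// ge0_fin_numE// integral_ge0.
have mE' : (\int[P]_w moment nu' w = m'%:E)%E.
  by rewrite /m' fineK// ge0_fin_numE// integral_ge0.
have m0 : 0 <= m by rewrite fine_ge0// integral_ge0.
have m0' : 0 <= m' by rewrite fine_ge0// integral_ge0.
exists (expR (s * c0) * (expR (3 * theta / 2) + (m + m') / 2)), (theta / 2).
split.
- by rewrite mulr_gt0 ?expR_gt0// ltr_wpDr ?expR_gt0// divr_ge0// addr_ge0.
- by rewrite divr_gt0.
move=> n; apply: (@le_trans _ _ (\int[P]_w bound n w)%E).
  apply: le_integral_nonmeasurable => // w; first exact: tv_norm_ge0.
have msq : measurable_fun setT (fun w => (up n * x_ n w ^+ 2)%:E).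
  by apply/measurable_EFinP; apply: measurable_funM => //; exact: measurable_funX.
have msum : measurable_fun setT (fun w => moment nu w + moment nu' w)%E.
  exact: emeasurable_funD.
have sq0 w : (0 <= (up n * x_ n w ^+ 2)%:E)%E.
  by rewrite lee_fin mulr_ge0 ?expR_ge0 ?sqr_ge0.
have sum0 w : (0 <= moment nu w + moment nu' w)%E by exact: adde_ge0.
have dsum0 w : (0 <= (dn n / 2)%:E * (moment nu w + moment nu' w))%E.
  by rewrite mule_ge0// lee_fin ltW.
have mdsum : measurable_fun setT
    (fun w => (dn n / 2)%:E * (moment nu w + moment nu' w))%E.
  exact: emeasurable_funM.
rewrite ge0_integralZl_EFin ?expR_ge0//; last 2 first.
- by move=> w _; exact: adde_ge0.
- exact: emeasurable_funD.
rewrite ge0_integralD// ge0_integralZl_EFin ?(ltW (dn_gt0 n))//.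
rewrite ge0_integralD// mE mE' -EFinD -EFinM.
under eq_integral do rewrite EFinM.
have xsq0 w : (0 <= (x_ n w ^+ 2)%:E)%E by rewrite lee_fin sqr_ge0.
have mxsq : measurable_fun setT (fun w => (x_ n w ^+ 2)%:E).
  by apply/measurable_EFinP; exact: measurable_funX.
rewrite ge0_integralZl_EFin ?expR_ge0//.
apply: (@le_trans _ _ ((expR (s * c0) * (up n *
   (expR (3 * theta / 2) * expR (- (3 * theta / 2) * n%:R)) +
   dn n / 2 * (m + m')))%:E)).
  rewrite [leRHS]EFinM [(up n * _ + _)%:E]EFinD [(up n * _)%:E]EFinM.
  apply: lee_wpmul2l; first by rewrite lee_fin expR_ge0.
  by apply: leeD2r; apply: lee_wpmul2l; [rewrite lee_fin expR_ge0|exact: x_sqr].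
rewrite lee_fin -[leRHS]mulrA ler_wpM2l ?expR_ge0//.
rewrite [leRHS](_ : _ = expR (3 * theta / 2) * dn n + dn n / 2 * (m + m')); last first.
  by rewrite /dn; ring.
rewrite lerD2r mulrCA ler_wpM2l ?expR_ge0// /up /dn -expRD ler_expR -mulrDl.
by rewrite ler_wpM2r//; move: theta_gt0; lra.
Qed.

End exponential_bound.

(** * Exponential stability of the filter *)

Theorem mainTheorem4
  (R : realType) (N p : nat) (hpN : (p <= N)%N)
  (f : 'rV[R]_N -> 'rV[R]_N) (h : 'rV[R]_N -> 'rV[R]_p)
  (mf : measurable_fun setT f) (mh : measurable_fun setT h)
  (gam : 'rV[R]_N -> R) (ups : 'rV[R]_p -> R)
  (gam_density : positive_density gam) (ups_density : positive_density ups)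
  (gam_bounds : forall r : R, 0 <= r ->
     [/\ (0 < gamma_minus gam r)%E, (gamma_minus gam r <= gamma_plus gam r)%E
       & (gamma_plus gam r < +oo)%E])
  (d : measure_display) (W : measurableType d) (P : probability W R)
  (X0 : {RV P >-> 'rV[R]_N})
  (zeta : nat -> {RV P >-> 'rV[R]_N}) (eps : nat -> {RV P >-> 'rV[R]_p})
  (eps_iid : iid_with_density P ups eps)
  (zeta_iid : iid_with_density P gam zeta)
  (zeta_eps_indep :
     independent_classes P <<s events zeta >> <<s events eps >>)
  (X0_indep : independent_classes P (events (fun _ : unit => X0))
     <<s events zeta `|` events eps >>)
  (X : nat -> W -> 'rV[R]_N) (Y : nat -> W -> 'rV[R]_p)
  (X_init : forall w, X 0%N w = X0 w)
  (X_dyn : forall k w, (1 <= k)%N -> X k w = f (X k.-1 w) + zeta k w)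
  (Y_obs : forall k w, Y k w = h (X k w) + eps k w)
  (a b0 b : R) (E1 : assumption_E1 f h a b0 b) (E2 : assumption_E2 ups)
  (Z_mgf : forall Delta : R, 0 < Delta ->
     exists2 tau : R, 0 < tau &
       forall lam : R, 0 <= lam -> lam < tau ->
         lne ('M_P (Zvar gam zeta eps a b0 b Delta 1) lam) \is a fin_num)
  (nu nu' : probability 'rV[R]_N R) (Delta : R) (Delta_gt0 : 0 < Delta)
  (moments : exists lam : R, [/\ 0 < lam,
       (\int[P]_w expeR (lam%:E * negpart (lne
          (nu_g_Q f h gam ups nu (Y 0%N w) (Cset h (Y 1%N w) Delta)))) < +oo)%E
     & (\int[P]_w expeR (lam%:E * negpart (lne
          (nu_g_Q f h gam ups nu' (Y 0%N w) (Cset h (Y 1%N w) Delta)))) < +oo)%E]) :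
  (limn_esup (fun n : nat => (n%:R^-1)%:E *
     lne (\int[P]_w tv_norm (fun A =>
       filter_dist f h gam ups nu n (Y^~ w) A
       - filter_dist f h gam ups nu' n (Y^~ w) A)))
   < 0)%E.
Proof.
have [zeta_indep zeta_dens] := zeta_iid; have [eps_indep eps_dens] := eps_iid.
have mx0 : measurable_fun setT (X 0%N).
  by rewrite (_ : X 0%N = X0)//; apply/funext.
have x_dyn k w : X k.+1 w = f (X k w) + zeta k.+1 w by exact: X_dyn.
have zeta_law k B : measurable B -> P (zeta k @^-1` B) = P (zeta 1%N @^-1` B).
  by move=> mB; rewrite !zeta_dens.
have eps_law k B : measurable B -> P (eps k @^-1` B) = P (eps 0%N @^-1` B).
  by move=> mB; rewrite !eps_dens.
have [lam [lam_gt0 moment_nu moment_nu']] := moments.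
have reduction a' b0' b' tau : 0 <= a' -> 0 <= b0' -> 0 <= b' ->
    assumption_E1 f h a' b0' b' -> 0 < tau ->
    (\int[P]_w (expR (tau * Zvar gam zeta eps a' b0' b' Delta 1 w))%:E < +oo)%E ->
    (limn_esup (fun n : nat => (n%:R^-1)%:E *
      lne (\int[P]_w tv_norm (fun A =>
        filter_dist f h gam ups nu n (Y^~ w) A
        - filter_dist f h gam ups nu' n (Y^~ w) A))) < 0)%E.
  move=> a0 b00 bge0 E1' tau_gt0 Zfin.
  have [K [c [K0 c0 bound]]] := exponential_bound mf mh gam_density ups_density
    gam_bounds mx0 zeta_indep eps_indep zeta_eps_indep zeta_law eps_law x_dyn Y_obs
    a0 b00 bge0 E1' E2 Delta_gt0 tau_gt0 lam_gt0 Zfin moment_nu moment_nu'.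
  exact: limsup_rate K0 c0 bound.
have [N0|N_gt0] := posnP N; last first.
  have [a0 b00 bge0] := E1_signs E1 N_gt0.
  have [tau tau_gt0 Zfin] := Z_mgf Delta Delta_gt0.
  have tau2 : 0 < tau / 2 by rewrite divr_gt0.
  apply: (reduction a b0 b (tau / 2)) => //.
  have := Zfin (tau / 2) (ltW tau2) _; rewrite ltr_pdivrMr// ltr_pMr// ltr1n => /(_ isT).
  rewrite /mmt_gen_fun unlock => Mfin; rewrite ltey; apply/eqP => Moo.
  move: Mfin; rewrite (_ : integral _ _ _ = +oo%E)// -Moo.
  by apply: eq_integral => w _; rewrite /= mulrC.
(* In dimension 0 every norm vanishes and the constants may be taken to be 0. *)
have [_ h_unif h_surj _] := E1.
apply: (reduction 0 0 0 1) => //.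
  by split => // x1 x2; rewrite (enorm_dim0 _ N0) mul0r ?addr0.
have ZE w : Zvar gam zeta eps 0 0 0 Delta 1 w = - ln (fine (gamma_minus gam 0)).
  rewrite /Zvar (enorm_dim0 (zeta 1%N w) N0); congr (- ln (fine (gamma_minus gam _))).
  by ring.
under eq_integral do rewrite ZE.
by rewrite integral_cst// lte_mul_pinfty// ?lee_fin ?expR_ge0// (le_lt_trans (probability_le1 P _))// ltry.
Qed.
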